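(* Let $X_1,\dots,X_n$ be independent random variables with values in measurable spaces $\mathfrak{X}_1,\dots,\mathfrak{X}_n$, respectively, and let $g\colon\mathfrak{X}_1\times\dots\times\mathfrak{X}_n\to\mathbb{R}$ be a measurable function that is separately Lipschitz with respect to measurable functions $\rho_i\colon\mathfrak{X}_i\times\mathfrak{X}_i\to\mathbb{R}$, $i=1,\dots,n$, that is, $$|g(x_1,\dots,x_{i-1},\tilde x_i,x_{i+1},\dots,x_n)-g(x_1,\dots,x_n)|\le\rho_i(\tilde x_i,x_i)$$ for all $i\in\{1,\dots,n\}$, all $(x_1,\dots,x_n)\in\mathfrak{X}_1\times\dots\times\mathfrak{X}_n$, and all $\tilde x_i\in\mathfrak{X}_i$. Let $Y:=g(X_1,\dots,X_n)$ and suppose that $Y$ has a finite mean. Take any real $t>2$. For each $i\in\{1,\dots,n\}$, take any $x_i$ and $y_i$ in $\mathfrak{X}_i$. Then $$\mathsf{E}|Y-\mathsf{E}Y|^t\le C_t\,C_A^{(t)}\sum_{i=1}^n\mathsf{E}\rho_i(X_i,x_i)^t+C_B^{(t)}\Big(\sum_{i=1}^n\mathsf{E}\rho_i(X_i,y_i)^2\Big)^{t/2},$$ where the constants $C_t$, $C_A^{(t)}$, $C_B^{(t)}$ are those defined in the context (for any admissible choice of the functions $p,q$ and of the positive numbers $\lambda_j$ there).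
   Context: Constant $C_t$ (for $t>2$): $C_t:=R(t,b_t)$, where $b_t$ is the unique maximizer over $b\in[0,\frac12]$ of $$R(t,b):=\big(b^{t-1}+(1-b)^{t-1}\big)\big(b^{\frac1{t-1}}+(1-b)^{\frac1{t-1}}\big)^{t-1}.$$ Constants $C_A^{(t)},C_B^{(t)}$: let $m:=\lfloor t/2\rfloor$, let $\lambda_0,\dots,\lambda_{m-1}$ be any positive real numbers, and let $p(\cdot),q(\cdot)$ be any real-valued functions on $[2,\infty)$ such that $p(2)+q(2)\ge1$, $p(2)>0$, $q(2)>0$; $p(s)\ge1$ and $q(s)\ge1$ for all $s>2$; and $p(s)^{1/(3-s)}+q(s)^{1/(3-s)}\le1$ for all $s>3$. Put $$c_j^{(t)}:=q(t-2j)\prod_{k=0}^{j-1}\frac{(t-2k)(t-2k-1)\,p(t-2k)}2\quad(0\le j\le m-1),\qquad \tilde c_m^{(t)}:=\prod_{j=0}^{m-1}\frac{(t-2j)(t-2j-1)\,p(t-2j)}2,$$ $$C_A^{(t)}:=\sum_{j=0}^{m-1}c_j^{(t)}\,\frac{t-2j-2}{t-2}\,\frac1{\lambda_j^{2j}\,j!},\qquad C_B^{(t)}:=\tilde c_m^{(t)}\prod_{j=1}^m\frac1{t/2-m+j}+\sum_{j=0}^{m-1}c_j^{(t)}\,\frac{2j}{t-2}\,\frac{\lambda_j^{t-2j-2}}{j!}.$$ Empty sums are $0$ and empty products are $1$. *)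

(* Defs.v *)
From HB Require Import structures.
From mathcomp Require Import all_boot all_order all_algebra.
From mathcomp Require Import all_classical all_reals all_analysis.

Set Implicit Arguments.
Unset Strict Implicit.
Unset Printing Implicit Defensive.

Import Order.TTheory GRing.Theory Num.Theory.
Import numFieldNormedType.Exports.

Local Open Scope classical_set_scope.
Local Open Scope ring_scope.

Section product_space.
Context {n : nat} {d : 'I_n -> measure_display}
        (T : forall i, measurableType (d i)).

Definition cylinders : set (set (forall i, T i)) :=
  \bigcup_i preimage_set_system setT (fun x : forall i, T i => x i) measurable.

(* The product T_0 * ... * T_(n-1) with its product sigma-algebra. *)
Definition prod_space := g_sigma_algebraType cylinders.

(* [dfwith x i z] is [x] with its [i]-th coordinate replaced by [z : T i]. *)
Definition separately_Lipschitz (R : realType) (g : prod_space -> R)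
    (rho : forall i, T i * T i -> R) : Prop :=
  forall (i : 'I_n) (x : forall j, T j) (z : T i),
    `|g (dfwith x i z) - g x| <= rho i (z, x i).

Definition mutually_independent (R : realType) (dO : measure_display)
    (Omega : measurableType dO) (P : probability Omega R)
    (X : forall i, Omega -> T i) : Prop :=
  forall (J : {set 'I_n}) (A : forall i, set (T i)),
    (forall i, i \in J -> measurable (A i)) ->
    (P (\bigcap_(i in [set` J]) (X i @^-1` A i)) =
     \prod_(i in J) P (X i @^-1` A i))%E.

End product_space.

Section constants.
Context {R : realType}.
Implicit Types (t b : R) (p q : R -> R) (lambda : nat -> R).

Definition Rfun t b : R :=
  (b `^ (t - 1) + (1 - b) `^ (t - 1)) *
  (b `^ (t - 1)^-1 + (1 - b) `^ (t - 1)^-1) `^ (t - 1).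

Definition is_maximizer t b : Prop :=
  0 <= b <= 2^-1 /\ (forall b', 0 <= b' <= 2^-1 -> Rfun t b' <= Rfun t b).

(* [get] selects an element of the set of maximizers, which is a singleton
   when 2 < t. *)
Definition b_max t : R := get [set b | is_maximizer t b].

Definition Ct t : R := Rfun t (b_max t).

(* Only the values of p and q on [2, +oo) are constrained, and only those
   enter the constants below, as 2 <= t - 2 j for j < floor (t / 2). *)
Record admissible p q : Prop := Admissible {
  admissible_sum2 : 1 <= p 2 + q 2 ;
  admissible_p2 : 0 < p 2 ;
  admissible_q2 : 0 < q 2 ;
  admissible_p_ge1 : forall s : R, 2 < s -> 1 <= p s ;
  admissible_q_ge1 : forall s : R, 2 < s -> 1 <= q s ;
  admissible_pq : forall s : R, 3 < s ->
    p s `^ (3 - s)^-1 + q s `^ (3 - s)^-1 <= 1 }.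

Definition half_floor t : nat := Num.truncn (t / 2).

(* With j := half_floor t, this product is the constant written
   c-tilde_m; times q (t - 2 j), it is c_j. *)
Definition pprod p t (j : nat) : R :=
  \prod_(k < j)
    ((t - 2 * k%:R) * (t - 2 * k%:R - 1) * p (t - 2 * k%:R) / 2).

Definition cj p q t (j : nat) : R := q (t - 2 * j%:R) * pprod p t j.

Definition CA p q lambda t : R :=
  \sum_(j < half_floor t)
    cj p q t j * ((t - 2 * j%:R - 2) / (t - 2)) *
    (lambda j ^+ (2 * j) * j`!%:R)^-1.

Definition CB p q lambda t : R :=
  let m := half_floor t in
  pprod p t m * \prod_(1 <= j < m.+1) (t / 2 - m%:R + j%:R)^-1 +
  \sum_(j < m)
    cj p q t j * (2 * j%:R / (t - 2)) *
    (lambda j `^ (t - 2 * j%:R - 2) / j`!%:R).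

End constants.

(* Main.v *)
(* The proof telescopes along the Doob martingale S_k of Y - E Y.

   A Taylor bound for |x + y|^s combined with the inequality
   |u + v|^(s-2) <= p |u|^(s-2) + q |v|^(s-2) gives, for s >= 2,
     E|S_k+1|^s <= E|S_k|^s + s(s-1)p/2 b_k E|S_k|^(s-2) + q E|xi_k|^s,
   where b_k bounds the conditional variance of the increment xi_k.  Iterating
   floor(t/2) times in s = t, t-2, ... ends with a moment of order < 2, which is
   controlled by the second moment; weighted AM-GM then splits the mixed terms
   B^j E|xi_k|^(t-2j) between E|xi_k|^t and B^(t/2), where B is the sum of the b_k.

   Given the past, xi_k is a centered function of X_k alone that oscillates by
   at most rho_k.  Recentering costs the factor C_t for the t-th moment and
   nothing for the variance.

   No conditional expectations are needed: S_k is obtained by averaging g over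
   an independent copy of the coordinates of index >= k, and the martingale
   property becomes the invariance of the law of X under resampling of one
   coordinate. *)

Require Import Defs.
From HB Require Import structures.
From mathcomp Require Import all_boot all_order all_algebra.
From mathcomp Require Import all_classical all_reals all_analysis.
From mathcomp Require Import measurable_realfun ring lra.

Set Implicit Arguments.
Unset Strict Implicit.
Unset Printing Implicit Defensive.

Import Order.TTheory GRing.Theory Num.Theory.
Import numFieldNormedType.Exports.

Local Open Scope classical_set_scope.
Local Open Scope ring_scope.

(** * Power inequalities *)

Section power_inequalities.
Context {R : realType}.
Implicit Types (a b u v x y p q s t P Q W : R).

Lemma ler_wpowR2 a x y : 0 <= a -> 0 <= x -> x <= y -> x `^ a <= y `^ a.
Proof.
by move=> a0 x0 xy; apply: ge0_ler_powR => //; rewrite nnegrE// (le_trans x0).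
Qed.

(** Young's inequality with conjugate exponents 1/th and 1/(1 - th); the endpoints, where one
    exponent would be infinite, are settled directly. *)
Lemma powR_weighted_mean a b (th : R) : 0 <= a -> 0 <= b -> 0 <= th <= 1 ->
  a `^ th * b `^ (1 - th) <= th * a + (1 - th) * b.
Proof.
move=> a0 b0 /andP[th0 th1].
have [->|tn0] := eqVneq th 0; first by rewrite powRr0 subr0 powRr1//; lra.
have [->|tn1] := eqVneq th 1; first by rewrite powRr1// subrr powRr0; lra.
have tp : 0 < th by rewrite lt_neqAle eq_sym tn0.
have tp1 : 0 < 1 - th by rewrite subr_gt0 lt_neqAle tn1.
have := @conjugate_powR R (a `^ th) (b `^ (1 - th)) th^-1 (1 - th)^-1.
rewrite !powR_ge0 !invr_gt0 !invrK -!powRrM !mulfV ?gt_eqF// !powRr1//.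
rewrite (addrC th) subrK => /(_ isT isT tp tp1 erefl).
by rewrite (mulrC a) (mulrC b).
Qed.

(** Convexity of z^a at the points u/P and v/Q with weights P/(P + Q) and Q/(P + Q). P and Q stay
    free because each use tunes them to its own coefficients. *)
Lemma powR_sum_le P Q a u v : 1 <= a -> 0 < P -> 0 < Q -> 0 <= u -> 0 <= v ->
  (u + v) `^ a <= (P + Q) `^ (a - 1) *
    (P `^ (1 - a) * u `^ a + Q `^ (1 - a) * v `^ a).
Proof.
move=> a1 P0 Q0 u0 v0.
have W0 : 0 < P + Q by rewrite addr_gt0.
have W1 : P / (P + Q) <= 1 by rewrite ler_pdivrMr// mul1r lerDl ltW.
have W2 : 0 <= P / (P + Q) by rewrite divr_ge0 ?ltW.
have W3 : 1 - P / (P + Q) = Q / (P + Q) by field; rewrite gt_eqF.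
pose w : {i01 R} := Itv01 W2 W1.
have := @convex_powR R a a1 w (u / P) (v / Q).
rewrite !inE /= !in_itv /= !andbT => /(_ (divr_ge0 u0 (ltW P0)) (divr_ge0 v0 (ltW Q0))) h.
rewrite convRE [X in X `^ _ <= _]convRE /= /unstable.onem W3 in h; move: h.
have -> : P / (P + Q) * (u / P) + Q / (P + Q) * (v / Q) = (u + v) / (P + Q).
  by field; rewrite !gt_eqF.
rewrite !powRM ?invr_ge0 ?addr_ge0 ?(ltW P0) ?(ltW Q0)//.
rewrite -!powR_inv1 ?(ltW P0) ?(ltW Q0) ?(ltW W0)// -!powRrM !mulN1r.
have PE z : 0 < z -> z `^ (1 - a) = z * z `^ (- a).
  by move=> z0; rewrite powRD ?powRr1 ?(ltW z0)// (gt_eqF z0) implybT.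
rewrite !PE//.
have -> : (P + Q) `^ (a - 1) = (P + Q) `^ (- 1) * (P + Q) `^ a.
  by rewrite (addrC a) powRD// (gt_eqF W0) implybT.
have Wa : 0 < (P + Q) `^ a by rewrite powR_gt0.
rewrite (powRN (P + Q) a) ler_pdivrMr//; set lhs := _ `^ a => h.
by apply: (le_trans h); rewrite le_eqVlt; apply/orP; left; apply/eqP; ring.
Qed.

(** The ratios u/(u + v) and v/(u + v) lie in [0, 1], so each is at most its a-th power, and they
    sum to 1. *)
Lemma powR_subadd a u v : 0 <= a <= 1 -> 0 <= u -> 0 <= v ->
  (u + v) `^ a <= u `^ a + v `^ a.
Proof.
move=> /andP[a0 a1]; rewrite le_eqVlt => /predU1P[<- _|u0].
  by rewrite add0r lerDr powR_ge0.
rewrite le_eqVlt => /predU1P[<-|v0]; first by rewrite addr0 lerDl powR_ge0.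
have w0 : 0 < u + v by rewrite addr_gt0.
have key x : 0 < x -> x <= u + v -> x / (u + v) <= x `^ a / (u + v) `^ a.
  move=> x0 xw; rewrite -powRN -[in X in _ <= _ * X]mulN1r powRrM.
  rewrite powR_inv1 ?(ltW w0)// -powRM ?invr_ge0 ?(ltW x0) ?(ltW w0)//.
  by rewrite ger1_powR// divr_gt0//= ler_pdivrMr// mul1r.
have := lerD (key u u0 _) (key v v0 _); rewrite lerDl lerDr (ltW u0) (ltW v0) => /(_ isT isT).
by rewrite -!mulrDl mulfV ?gt_eqF// ler_pdivlMr ?powR_gt0// mul1r.
Qed.

(** At s = 2 every power is 1 and p(2) + q(2) >= 1 is the claim; up to s = 3 the power is
    subadditive; beyond 3 it is convex and the third condition on p, q enters. *)
Lemma norm_powR_quasi_triangle (p q : R -> R) s u v : admissible p q -> 2 <= s ->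
  `|u + v| `^ (s - 2) <= p s * `|u| `^ (s - 2) + q s * `|v| `^ (s - 2).
Proof.
move=> [pq2 p2 q2 p1 q1 pq]; rewrite le_eqVlt => /predU1P[<-|s2].
  by rewrite subrr !powRr0 !mulr1.
have a0 : 0 <= s - 2 by rewrite subr_ge0 ltW.
have tri : `|u + v| `^ (s - 2) <= (`|u| + `|v|) `^ (s - 2).
  by apply: ler_wpowR2 => //; exact: ler_normD.
apply: (le_trans tri); have [s3|s3] := leP s 3.
  apply: (@le_trans _ _ (`|u| `^ (s - 2) + `|v| `^ (s - 2))).
    by apply: powR_subadd => //; rewrite a0/=; lra.
  by apply: lerD; apply: ler_peMl; rewrite ?powR_ge0 ?p1 ?q1.
have ps0 : 0 < p s by rewrite (lt_le_trans ltr01)// p1.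
have qs0 : 0 < q s by rewrite (lt_le_trans ltr01)// q1.
have s30 : 3 - s != 0 by rewrite lt_eqF// subr_lt0.
have a1 : 1 <= s - 2 by lra.
(* With P = p(s)^(1/(3 - s)), the coefficient P^(3 - s) is p(s), and likewise for q; the prefactor
   is at most 1 since P + Q <= 1. *)
apply: (le_trans (powR_sum_le a1 (powR_gt0 (3 - s)^-1 ps0)
  (powR_gt0 (3 - s)^-1 qs0) (normr_ge0 u) (normr_ge0 v))).
have -> : 1 - (s - 2) = 3 - s by ring.
rewrite -!powRrM !mulVf// !powRr1 ?(ltW ps0) ?(ltW qs0)//.
apply: ler_piMl; first by rewrite addr_ge0// mulr_ge0 ?powR_ge0// ltW.
rewrite -[leRHS](_ : 1 `^ (s - 2 - 1) = 1); last by rewrite powR1.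
by apply: ler_wpowR2; [lra|exact: addr_ge0 (powR_ge0 _ _) (powR_ge0 _ _)|exact: pq].
Qed.

(** The tangent inequality for a convex power, obtained from the weighted mean of b^(s+1) and (b +
    v)^(s+1) with weight s/(s + 1) on the former. *)
Lemma powR_add_ge b v s : 0 <= b -> 0 <= v -> 0 <= s ->
  b `^ (s + 1) + (s + 1) * (v * b `^ s) <= (b + v) `^ (s + 1).
Proof.
move=> b0 v0 s0; have s1 : s + 1 != 0 by rewrite gt_eqF//; lra.
have th : 0 <= s / (s + 1) <= 1.
  by rewrite divr_ge0//=; [rewrite ler_pdivrMr//; lra|lra].
have := powR_weighted_mean (powR_ge0 b (s + 1)) (powR_ge0 (b + v) (s + 1)) th.
have -> : 1 - s / (s + 1) = (s + 1)^-1 by field.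
rewrite -!powRrM; have -> : (s + 1) * (s / (s + 1)) = s by field.
rewrite mulfV// powRr1 ?addr_ge0//.
have sp : 0 < s + 1 by lra.
rewrite powRD ?powRr1//; last by rewrite (negPf s1).
move: (b `^ s) (_ `^ (s + 1)) => Z W.
have -> : s / (s + 1) * (Z * b) + (s + 1)^-1 * W = (s * (Z * b) + W) / (s + 1).
  by field.
by rewrite ler_pdivlMr//; lra.
Qed.

(** The order t - 2j is the mean of t and 2 with weight th on t. In the weighted geometric mean of
    the two right-hand terms the powers of la cancel and those of B combine to B^j. *)
Lemma powR_interpolation (t la B y : R) (j : nat) : 2 < t -> 2 * j%:R <= t - 2 ->
  0 < la -> 0 <= B -> 0 <= y ->
  B ^+ j * y `^ (t - 2 * j%:R) <=
    (t - 2 * j%:R - 2) / (t - 2) * (la ^+ (2 * j))^-1 * y `^ t +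
    2 * j%:R / (t - 2) * la `^ (t - 2 * j%:R - 2) * (B `^ (t / 2 - 1) * y ^+ 2).
Proof.
move=> t2 jt la0 B0 y0; rewrite -(powR_mulrn 2 y0).
have t20 : t - 2 != 0 by rewrite gt_eqF//; lra.
case: j jt => [_|j jt].
  by rewrite !expr0 !mulr0 !subr0 !mul0r addr0 mulfV// invr1 !mul1r.
set k := j.+1 in jt *; have k0 : 0 < k%:R :> R by rewrite ltr0n.
pose th := (t - 2 * k%:R - 2) / (t - 2).
have th1 : 1 - th = 2 * k%:R / (t - 2) by rewrite /th; field.
have th01 : 0 <= th <= 1.
  by rewrite divr_ge0//= ?ler_pdivrMr//; lra.
rewrite -/th -th1.
have a0 : 0 <= (la ^+ (2 * k))^-1 * y `^ t.
  by rewrite mulr_ge0 ?powR_ge0// invr_ge0 exprn_ge0// ltW.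
have b0 : 0 <= la `^ (t - 2 * k%:R - 2) * (B `^ (t / 2 - 1) * y `^ 2).
  by rewrite !mulr_ge0 ?powR_ge0.
rewrite -!(mulrA _ _ (y `^ t)) -!(mulrA _ _ (_ * y `^ 2)).
apply: le_trans (powR_weighted_mean a0 b0 th01).
rewrite !powRM ?powR_ge0 ?mulr_ge0 ?invr_ge0 ?exprn_ge0 ?powR_ge0 ?(ltW la0)//.
rewrite -!powR_mulrn ?(ltW la0)// -powRN -!powRrM.
have -> : (t / 2 - 1) * (1 - th) = k%:R by rewrite th1; field.
have -> : la `^ (- (2 * k)%:R * th) * y `^ (t * th) *
    (la `^ ((t - 2 * k%:R - 2) * (1 - th)) * (B `^ k%:R * y `^ (2 * (1 - th)))) =
    (la `^ (- (2 * k)%:R * th) * la `^ ((t - 2 * k%:R - 2) * (1 - th))) *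
    (B `^ k%:R * (y `^ (t * th) * y `^ (2 * (1 - th)))) by ring.
rewrite -!powRD.
- have -> : - (2 * k)%:R * th + (t - 2 * k%:R - 2) * (1 - th) = 0.
    by rewrite th1 /th natrM; field.
  have -> : t * th + 2 * (1 - th) = t - 2 * k%:R by rewrite th1 /th; field.
  by rewrite powRr0 mul1r.
- have -> : t * th + 2 * (1 - th) = t - 2 * k%:R by rewrite th1 /th; field.
  by rewrite gt_eqF//; lra.
- by rewrite (gt_eqF la0) implybT.
Qed.
End power_inequalities.

(** * Derivatives of powers of the absolute value and the Taylor bound *)

Section smoothness.
Context {R : realType}.
Implicit Types (a e s u v x y : R).

Lemma continuous_norm_powR e : 0 < e -> continuous (fun z : R => `|z| `^ e).
Proof.
move=> e0 x; have [->|x0] := eqVneq x 0.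
  apply/cvgrPdist_lt => eps eps0; near=> z.
  rewrite normr0 powR0 ?gt_eqF// sub0r normrN ger0_norm ?powR_ge0//.
  have -> : eps = (eps `^ e^-1) `^ e by rewrite -powRrM mulVf ?gt_eqF// powRr1 ?ltW.
  rewrite gt0_ltr_powR ?nnegrE ?powR_ge0//.
  near: z; apply: cvgr0_norm_lt; first exact: cvg_id.
  by rewrite powR_gt0.
apply: (@continuous_comp _ _ _ (Num.norm : R -> R) (@powR R ^~ e)).
  exact: norm_continuous.
apply/differentiable_continuous/derivable1_diffP/derivable_powR.
by rewrite in_itv/= andbT normr_gt0.
Unshelve. all: by end_near. Qed.

(** An odd function: computed on the positive half-line, reflected to the negative one, and treated
    at 0 through its slope function |z|^e. For e = 0 it is the identity, and the formula at 0 relies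
    on 0^0 = 1. *)
Lemma is_derive_signed_powR e x : 0 <= e ->
  is_derive x 1 (fun z : R => z * `|z| `^ e) ((e + 1) * `|x| `^ e).
Proof.
move=> e0.
have pos (z : R) : 0 < z -> is_derive z 1 (fun z : R => z * `|z| `^ e) ((e + 1) * `|z| `^ e).
  move=> z0; apply: (@near_eq_is_derive _ _ _ (fun z : R => z `^ (e + 1))).
    near=> w; have w0 : 0 < w by near: w; exact: lt_nbhsr.
    rewrite gtr0_norm// addrC powRD ?powRr1 ?(ltW w0)//.
    by rewrite (gt_eqF w0) implybT.
  rewrite gtr0_norm//.
  by have := is_derive1_powR (e + 1) z0; rewrite addrK.
have [x0|x0|->] := ltgtP x 0; last 1 first.
- move: e0; rewrite le_eqVlt => /predU1P[<-|e0].
    rewrite powRr0 add0r mulr1; have -> : (fun z : R => z * `|z| `^ 0) = id.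
      by apply/funext => z; rewrite powRr0 mulr1.
    exact: is_derive_id.
  apply/is_derive1_caratheodory; exists (fun z : R => `|z| `^ e); split.
  + by move=> z; rewrite normr0 mul0r !subr0 mulrC.
  + exact: continuous_norm_powR.
  + by rewrite normr0 powR0 ?mulr0// gt_eqF.
- have -> : (fun z : R => z * `|z| `^ e) = - ((fun z : R => z * `|z| `^ e) \o -%R).
    by apply/funext => z /=; rewrite /GRing.opp/= normrN mulNr opprK.
  have nx0 : 0 < - x by rewrite oppr_gt0.
  have h := is_derive1_comp (pos _ nx0) (is_deriveNid x 1).
  have := is_deriveN h; rewrite normrN mulrN1 opprK; exact.
- exact: pos.
Unshelve. all: by end_near. Qed.

(** Writing |z|^s as z times (z |z|^(s-2)) lets the product rule cover the origin as well. *)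
Lemma is_derive_norm_powR s x : 2 <= s ->
  is_derive x 1 (fun z : R => `|z| `^ s) (s * (x * `|x| `^ (s - 2))).
Proof.
move=> s2; have -> : (fun z : R => `|z| `^ s) = id * (fun z : R => z * `|z| `^ (s - 2)).
  apply/funext => z /=; rewrite -[RHS]/(z * (z * _)) mulrA -expr2 -real_normK ?num_real//.
  rewrite -powR_mulrn// -powRD; first by congr (_ `^ _); ring.
  by rewrite addrC subrK gt_eqF//; lra.
have e0 : 0 <= s - 2 by lra.
have := is_derive_signed_powR x e0 => h.
apply: (is_derive_eq (is_deriveM (is_derive_id x 1) h)). rewrite /GRing.scale/=; ring.
Qed.

(** The derivative is nondecreasing and vanishes at 0, so f falls before 0 and rises after it. *)
Lemma convex_tangent_ge0 (f f' f'' : R -> R) :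
  (forall x, is_derive x 1 f (f' x)) -> (forall x, is_derive x 1 f' (f'' x)) ->
  (forall x, 0 <= f'' x) -> f 0 = 0 -> f' 0 = 0 -> forall x, 0 <= f x.
Proof.
move=> df df' f''0 f0 f'0 x.
have cf (g g' : R -> R) : (forall x, is_derive x 1 g (g' x)) -> continuous g.
  move=> dg z; apply/differentiable_continuous/derivable1_diffP.
  exact: (@ex_derive _ _ _ _ _ _ _ (dg z)).
have mono' a b : a <= b -> f' a <= f' b.
  move=> ab; apply: (@ger0_derive1_ndecr _ f' a b) => //.
  - by move=> z _; rewrite derive1E; rewrite (@derive_val _ _ _ _ _ _ _ (df' z)).
  - exact/continuous_subspaceT/(cf _ _ df').
have [x0|/ltW x0] := leP 0 x.
  rewrite -f0; apply: (@ger0_derive1_ndecr _ f 0 x) => //.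
  - move=> z; rewrite in_itv/= => /andP[z0 _]; rewrite derive1E.
    by rewrite (@derive_val _ _ _ _ _ _ _ (df z)) -f'0 mono'// ltW.
  - exact/continuous_subspaceT/(cf _ _ df).
rewrite -f0; apply: (@ler0_derive1_nincr _ f x 0) => //.
- move=> z; rewrite in_itv/= => /andP[_ z0]; rewrite derive1E.
  by rewrite (@derive_val _ _ _ _ _ _ _ (df z)) -f'0 mono'// ltW.
- exact/continuous_subspaceT/(cf _ _ df).
Qed.

(** As a function of y, right side minus left side vanishes to first order at 0, and its second
    derivative is s(s-1) times the gap in the assumed inequality. The linear term is kept exact
    because it integrates to zero against a centered increment. *)
Lemma norm_powR_taylor s p q x y : 2 <= s ->
  (forall u v, `|u + v| `^ (s - 2) <= p * `|u| `^ (s - 2) + q * `|v| `^ (s - 2)) ->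
  `|x + y| `^ s <= `|x| `^ s + s * (s - 1) * p / 2 * `|x| `^ (s - 2) * y ^+ 2
    + q * `|y| `^ s + s * (x * `|x| `^ (s - 2)) * y.
Proof.
move=> s2 hpq.
pose N (z : R) : R := `|z| `^ s.
pose D (z : R) : R := z * `|z| `^ (s - 2).
pose L (z : R) : R := `|z| `^ (s - 2).
have e0 : 0 <= s - 2 by lra.
have dN (z : R) : is_derive z 1 N (s * D z) by exact: is_derive_norm_powR.
have dD (z : R) : is_derive z 1 D ((s - 1) * L z).
  by apply: is_derive_eq (is_derive_signed_powR z e0) _; rewrite /L; congr (_ * _); ring.
have shift_derive (f f' : R -> R) (z : R) : (forall z : R, is_derive z 1 f (f' z)) ->
    is_derive z 1 (f \o +%R x) (f' (x + z)).
  move=> df; have h : is_derive z 1 (+%R x) 1.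
    have := is_deriveD (is_derive_cst x z 1) (is_derive_id z 1).
    by rewrite add0r; exact.
  by apply: is_derive_eq (is_derive1_comp (df (x + z)) h) _; rewrite mulr1.
pose f (z : R) : R := N x + s * (s - 1) * p / 2 * L x * z ^+ 2 + q * N z
  + s * D x * z - N (x + z).
pose f' (z : R) : R := s * (s - 1) * p * L x * z + q * (s * D z)
  + s * D x - s * D (x + z).
pose f'' (z : R) : R := s * (s - 1) * (p * L x + q * L z - L (x + z)).
suff : 0 <= f y by rewrite /f subr_ge0.
have dI z := is_derive_id (z : R) (1 : R).
refine (@convex_tangent_ge0 f f' f'' _ _ _ _ _ y).
- move=> z; have h1 := shift_derive _ _ z dN.
  have h := is_deriveB (is_deriveD (is_deriveD (is_deriveD
    (is_derive_cst (N x) z 1)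
    (is_deriveZ (s * (s - 1) * p / 2 * L x) (is_deriveX 2 (dI z))))
    (is_deriveZ q (dN z))) (is_deriveZ (s * D x) (dI z))) h1.
  apply: (is_derive_eq h).
  by rewrite /f' /GRing.scale/=; field.
- move=> z; have h1 := shift_derive _ _ z dD.
  have h := is_deriveB (is_deriveD (is_deriveD
    (is_deriveZ (s * (s - 1) * p * L x) (dI z))
    (is_deriveZ q (is_deriveZ s (dD z))))
    (is_derive_cst (s * D x) z 1)) (is_deriveZ s h1).
  apply: (is_derive_eq h).
  by rewrite /f'' /GRing.scale/=; ring.
- by move=> z; rewrite !mulr_ge0 ?subr_ge0 ?hpq//; lra.
- by rewrite /f /N addr0 normr0 powR0 ?gt_eqF//; [ring|lra].
- by rewrite /f' /D addr0; ring.
Qed.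

End smoothness.

(** * Recentering *)

Section recentering.
Context {R : realType}.
Implicit Types (t b c m x y z : R).

(** [b_max] is picked by [get], so its property rests on the existence of a maximizer, given by
    compactness of [0, 1/2]. The symmetry b -> 1 - b extends the bound to [0, 1]. *)
Lemma Rfun_le_Ct t b : 2 < t -> 0 <= b <= 1 -> Rfun t b <= Ct t.
Proof.
move=> t2 b01.
have t1 : 0 < t - 1 by lra.
have it1 : 0 < (t - 1)^-1 by rewrite invr_gt0.
have cN e (f : R -> R) : 0 < e -> continuous f -> continuous (fun u => `|f u| `^ e).
  move=> e0 cf u; apply: (@continuous_comp _ _ _ f (fun z : R => `|z| `^ e)).
    exact: cf.
  exact: continuous_norm_powR.
(* Absolute values make the function continuous on the whole line without changing it on [0, 1]. *)
pose G (u : R) : R := (`|u| `^ (t - 1) + `|1 - u| `^ (t - 1)) *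
  `| `|u| `^ (t - 1)^-1 + `|1 - u| `^ (t - 1)^-1 | `^ (t - 1).
have cI : continuous (fun u : R => u) by move=> u; exact: cvg_id.
have cJ : continuous (fun u : R => 1 - u).
  by move=> u; apply: cvgB; [exact: cvg_cst|exact: cvg_id].
have cG : continuous G.
  have c3 : continuous (fun u : R => `|u| `^ (t - 1)^-1 + `|1 - u| `^ (t - 1)^-1).
    by move=> u; apply: cvgD; [exact: (cN _ _ it1 cI)|exact: (cN _ _ it1 cJ)].
  move=> u; apply: cvgM; last exact: (cN _ _ t1 c3).
  by apply: cvgD; [exact: (cN _ _ t1 cI)|exact: (cN _ _ t1 cJ)].
have GE u : 0 <= u <= 1 -> G u = Rfun t u.
  move=> /andP[u0 u1]; rewrite /G /Rfun !ger0_norm ?subr_ge0//.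
  by rewrite addr_ge0 ?powR_ge0.
have half0 : 0 <= 2^-1 :> R by lra.
have half1 : 2^-1 <= 1 :> R by lra.
have [c] := EVT_max half0 (continuous_subspaceT cG).
rewrite in_itv/= => c01 cmax.
have cm : [set b | is_maximizer t b] c.
  split=> [|b' /andP[b'0 b'1]]; first exact: c01.
  have := cmax b'; rewrite in_itv/= b'0 b'1 => /(_ isT).
  by move: c01 => /andP[c0 c1]; rewrite !GE// ?c0 ?b'0/= ?(le_trans c1) ?(le_trans b'1).
have [_ hmax] : is_maximizer t (b_max t) := getI cm.
case: (leP b 2^-1) => hb.
  by apply: hmax; rewrite hb andbT; case/andP: b01.
have -> : Rfun t b = Rfun t (1 - b).
  by rewrite /Rfun subKr (addrC (b `^ (t - 1))) (addrC (b `^ (t - 1)^-1)).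
by apply: hmax; move: b01 hb; lra.
Qed.

(** R(t, 0) = 1. *)
Lemma Ct_ge1 t : 2 < t -> 1 <= Ct t.
Proof.
move=> t2; apply: le_trans (@Rfun_le_Ct t 0 t2 _); last by rewrite lexx ler01.
rewrite /Rfun subr0 powR1 !powR0 ?invr_eq0 ?gt_eqF ?add0r ?powR1 ?mul1r//; lra.
Qed.

(* The maximum over b arises here: with b = v / (u + v), Hoelder's inequality makes
   R(t, b) the exact ratio of the two sides minimized over c. *)
Lemma recentering_two_points t c u v z : 2 < t -> 0 < u -> 0 < v ->
  v * u `^ t + u * v `^ t <=
    Ct t * (v * `|z + u - c| `^ t + u * `|z - v - c| `^ t).
Proof.
move=> t2 u0 v0; have w0 : 0 < u + v by rewrite addr_gt0.
pose b := v / (u + v).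
have b0 : 0 < b by rewrite divr_gt0.
have b1 : 0 < 1 - b.
  by rewrite /b (_ : 1 - _ = u / (u + v)) ?divr_gt0//; field; rewrite gt_eqF.
have t1 : 0 < t - 1 by lra.
have t10 : t - 1 != 0 by rewrite gt_eqF.
have t1' : 1 <= t by lra.
have t0 : 0 < t by lra.
set A := `|z + u - c|; set B := `|z - v - c|.
(* The points z + u and z - v are u + v apart, so their distances to c sum to at least that. *)
have AB : u + v <= A + B.
  have -> : u + v = (z + u - c) - (z - v - c) by ring.
  by rewrite (le_trans (ler_norm _))// ler_normB.
have uE : u = (u + v) * (1 - b) by rewrite /b; field; rewrite gt_eqF.
have vE : v = (u + v) * b by rewrite /b; field; rewrite gt_eqF.
have hR : Rfun t b <= Ct t by apply: Rfun_le_Ct => //; apply/andP; split; lra.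
(* P = b^(-1/(t-1)) and Q = (1-b)^(-1/(t-1)) make the coefficients P^(1-t) and Q^(1-t) equal to b
   and 1 - b. *)
have P0 := powR_gt0 (- (t - 1)^-1) b0; have Q0 := powR_gt0 (- (t - 1)^-1) b1.
have := powR_sum_le t1' P0 Q0 (normr_ge0 (z + u - c)) (normr_ge0 (z - v - c)).
rewrite -/A -/B -!powRrM.
have -> : - (t - 1)^-1 * (1 - t) = 1 by field.
rewrite !powRr1 ?(ltW b0) ?(ltW b1)// => hH.
have {}hH : (u + v) `^ t <= (b `^ (- (t - 1)^-1) + (1 - b) `^ (- (t - 1)^-1)) `^ (t - 1)
    * (b * A `^ t + (1 - b) * B `^ t).
  by apply: le_trans hH; apply: ler_wpowR2 => //; lra.
(* Absorbing b(1 - b) into the (t-1)-th power turns the negative exponents into the positive ones in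
   the definition of R. *)
have key : (b * (1 - b)) * (b `^ (- (t - 1)^-1) + (1 - b) `^ (- (t - 1)^-1)) `^ (t - 1)
   = (b `^ (t - 1)^-1 + (1 - b) `^ (t - 1)^-1) `^ (t - 1).
  have bb0 : 0 <= b * (1 - b) by rewrite mulr_ge0// ltW.
  have -> : b * (1 - b) = ((b * (1 - b)) `^ (t - 1)^-1) `^ (t - 1).
    by rewrite -powRrM mulVf// powRr1.
  rewrite -powRM ?powR_ge0 ?addr_ge0 ?powR_ge0//; congr (_ `^ _).
  rewrite powRM ?ltW// !powRN; field.
  by rewrite !gt_eqF ?powR_gt0.
have pE x : 0 < x -> x `^ t = x * x `^ (t - 1).
  by move=> x0; rewrite mulr_powRB1 ?(ltW x0).
have uT : u `^ t = (u + v) `^ t * ((1 - b) * (1 - b) `^ (t - 1)).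
  by rewrite -(pE _ b1) -powRM ?(ltW w0) ?(ltW b1)// -uE.
have vT : v `^ t = (u + v) `^ t * (b * b `^ (t - 1)).
  by rewrite -(pE _ b0) -powRM ?(ltW w0) ?(ltW b0)// -vE.
have -> : v * u `^ t + u * v `^ t =
    (u + v) * ((u + v) `^ t * ((b * (1 - b)) * (b `^ (t - 1) + (1 - b) `^ (t - 1)))).
  rewrite uT vT [X in X * _ + _]vE [X in _ + X * _]uE.
  move: (_ `^ t) (b `^ _) (_ `^ (t - 1)) => W1 W2 W3.
  by move: (u + v) => W; ring.
have S0 : 0 <= b * A `^ t + (1 - b) * B `^ t.
  by apply: addr_ge0; apply: mulr_ge0; rewrite ?powR_ge0 ?(ltW b0) ?(ltW b1).
have -> : v * A `^ t + u * B `^ t = (u + v) * (b * A `^ t + (1 - b) * B `^ t).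
  by rewrite [X in X * _ + _]vE [X in _ + X * _]uE; move: (u + v) => W; ring.
rewrite [leRHS]mulrCA ler_wpM2l ?(ltW w0)//.
apply: le_trans (ler_wpM2r S0 hR).
have W0 : 0 <= (b * (1 - b)) * (b `^ (t - 1) + (1 - b) `^ (t - 1)).
  by apply: mulr_ge0; [exact: mulr_ge0 (ltW b0) (ltW b1)|rewrite addr_ge0 ?powR_ge0].
apply: le_trans (ler_wpM2r W0 hH) _.
by rewrite /Rfun -key le_eqVlt; apply/orP; left; apply/eqP; ring.
Qed.

(* Integrated against a law of mean m, the linear term vanishes; its slope l separates
   the difference quotients on the two sides of m. *)
Lemma recentering t c m : 2 < t ->
  exists l : R, forall z, `|z - m| `^ t <= Ct t * `|z - c| `^ t + l * (z - m).
Proof.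
move=> t2; have C1 := Ct_ge1 t2.
pose f z := `|z - m| `^ t - Ct t * `|z - c| `^ t.
(* The two-point inequality at z = m: every quotient from the right is at most every quotient from
   the left, so the supremum of the former separates them. *)
have two u v : 0 < u -> 0 < v -> f (m + u) / u <= - f (m - v) / v.
  move=> u0 v0; have h := recentering_two_points c m t2 u0 v0.
  rewrite ler_pdivrMr// mulrAC ler_pdivlMr// /f.
  rewrite (_ : m + u - m = u); last by ring.
  rewrite (_ : m - v - m = - v); last by ring.
  by rewrite normrN (gtr0_norm u0) (gtr0_norm v0); lra.
pose A := [set f (m + u) / u | u in [set u | 0 < u]].
have A0 : has_sup A.
  split; first by exists (f (m + 1) / 1), 1 => //=.
  by exists (- f (m - 1) / 1) => _ [u /= u0 <-]; apply: two.
exists (sup A) => z; rewrite -lerBlDl -/(f z).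
have [zm|zm|->] := ltgtP z m.
- pose v := m - z; have v0 : 0 < v by rewrite subr_gt0.
  have : sup A <= - f (m - v) / v.
    by apply: ge_sup; [case: A0|move=> _ [u /= u0 <-]; apply: two].
  by rewrite ler_pdivlMr// /v subKr; lra.
- pose u := z - m; have u0 : 0 < u by rewrite subr_gt0.
  have : f (m + u) / u <= sup A.
    by apply: sup_upper_bound => //; exists u.
  by rewrite ler_pdivrMr// /u subrKC.
- have t0 : 0 < t by lra.
  rewrite /f subrr mulr0 normr0 powR0 ?(gt_eqF t0)//.
  by rewrite sub0r oppr_le0 mulr_ge0 ?powR_ge0//; lra.
Qed.

End recentering.

(** * The moment recursion *)

Section unrolling.
Context {R : realType}.
Implicit Types (K q b : nat -> R) (a al : nat -> nat -> R) (r : R).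

(** A discrete form of the integral of B^r dB being B^(r+1)/(r+1). *)
Lemma sum_mul_powR_le b r k : (forall i, 0 <= b i) -> 0 <= r ->
  \sum_(i < k) b i * (\sum_(h < i) b h) `^ r <=
    (\sum_(i < k) b i) `^ (r + 1) * (r + 1)^-1.
Proof.
move=> b0 r0; have r1 : 0 < r + 1 by rewrite ltr_wpDl.
elim: k => [|k IH]; first by rewrite !big_ord0 mulr_ge0 ?powR_ge0// invr_ge0 ltW.
rewrite !big_ord_recr/=.
have B0 : 0 <= \sum_(i < k) b i by apply: sumr_ge0 => i _; exact: b0.
have := powR_add_ge B0 (b0 k) r0.
move: IH; rewrite !ler_pdivlMr// => IH h; lra.
Qed.

(** Here [al j k] stands for the moment of order t - 2j at time k and [a j i] for that of the i-th
    increment. Induction on the number of levels: each summation over time raises the power of the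
    partial sum of [b] by one, and the resulting divisors build j! and the product of the r + j. *)
Lemma unroll_recursion (l n : nat) K q b a al r : 0 <= r ->
  (forall j, (j < l)%N -> 0 <= K j) -> (forall j, (j < l)%N -> 0 <= q j) ->
  (forall i, 0 <= b i) -> (forall j i, (j < l)%N -> 0 <= a j i) ->
  (forall j, (j < l)%N -> al j 0%N = 0) ->
  (forall j k, (j < l)%N -> (k < n)%N ->
     al j k.+1 <= al j k + K j * b k * al j.+1 k + q j * a j k) ->
  (forall k, (k <= n)%N -> al l k <= (\sum_(i < k) b i) `^ r) ->
  forall k, (k <= n)%N ->
  al 0%N k <= \sum_(j < l) (\prod_(i < j) K i) * q j *
      ((\sum_(i < k) b i) ^+ j / j`!%:R) * \sum_(i < k) a j i +
    (\prod_(i < l) K i) * ((\sum_(i < k) b i) `^ (r + l%:R) *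
      \prod_(1 <= j < l.+1) (r + j%:R)^-1).
Proof.
move=> r0; elim: l K q a al => [|l IH] K q a al K0 q0 b0 a0 al0 rec last k kn.
  by rewrite !big_ord0 big_geq// addr0 add0r mulr1 mul1r last.
pose Bs k := \sum_(i < k) b i.
have Bs0 i : 0 <= Bs i by apply: sumr_ge0 => j _; exact: b0.
(* Levels 1 to l + 1 satisfy the same hypotheses after a shift. *)
have {}IH := IH (fun j => K j.+1) (fun j => q j.+1) (fun j => a j.+1) (fun j => al j.+1)
  (fun j => K0 j.+1) (fun j => q0 j.+1) b0 (fun j i => a0 j.+1 i)
  (fun j => al0 j.+1) (fun j k => rec j.+1 k) last.
(* Level 0 telescoped in time. *)
have step i : (i <= n)%N -> al 0%N i <=
    K 0%N * (\sum_(h < i) b h * al 1%N h) + q 0%N * \sum_(h < i) a 0%N h.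
  elim: i => [_|i IHi il]; first by rewrite al0// !big_ord0 !mulr0 addr0.
  rewrite !big_ord_recr/=; have := IHi (ltnW il); have := rec 0%N i isT il; lra.
apply: (le_trans (step k kn)).
rewrite [X in _ <= X + _]big_ord_recl/= big_ord0 mul1r expr0 fact0 invr1 mulr1 mulr1.
rewrite [leLHS]addrC -addrA lerD2l.
pose Q := \prod_(1 <= j < l.+1) (r + j%:R)^-1.
have Q0 : 0 <= Q.
  by apply: prodr_ge0 => j _; rewrite invr_ge0 addr_ge0.
have PK0 j : (j <= l)%N -> 0 <= \prod_(i < j) K i.+1.
  by move=> jl; apply: prodr_ge0 => i _; apply: K0; rewrite ltnS (leq_trans _ jl)// ltn_ord.
(* The increment sums are enlarged to the final time k, so that only powers of [Bs h] still depend
   on h. *)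
pose c j := (\prod_(i < j) K i.+1) * q j.+1 * (j`!%:R)^-1 * \sum_(i < k) a j.+1 i.
have c0 j : (j < l)%N -> 0 <= c j.
  move=> jl; apply: mulr_ge0; last by apply: sumr_ge0 => i _; rewrite a0// ltnS.
  by rewrite !mulr_ge0 ?PK0 ?q0 ?invr_ge0 ?ltnS// ltnW.
have bound h : (h < k)%N -> al 1%N h <=
    \sum_(j < l) c j * Bs h `^ j%:R + (\prod_(i < l) K i.+1) * Q * Bs h `^ (r + l%:R).
  move=> hk; apply: (le_trans (IH h (leq_trans (ltnW hk) kn))).
  rewrite -/(Bs h) -/Q -mulrA (mulrC Q) lerD2r; apply: ler_sum => j _.
  have aS : \sum_(i < h) a j.+1 i <= \sum_(i < k) a j.+1 i.
    rewrite -!(big_mkord xpredT (a j.+1)) [leRHS](@big_cat_nat _ _ _ h)//=; last exact: ltnW.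
    by rewrite lerDl sumr_ge0// => i _; rewrite a0// ltnS.
  rewrite /c powR_mulrn// [leRHS]mulrAC (mulrAC _ (_^-1)) (mulrA _ (_ ^+ _)).
  apply: ler_wpM2l aS; rewrite !mulr_ge0 ?PK0 ?q0 ?exprn_ge0 ?invr_ge0 ?ltnS//.
  exact: ltnW.
have : \sum_(h < k) b h * al 1%N h <= \sum_(j < l) c j * (Bs k `^ (j%:R + 1) * (j%:R + 1)^-1)
   + (\prod_(i < l) K i.+1) * Q * (Bs k `^ (r + l%:R + 1) * (r + l%:R + 1)^-1).
  apply: (@le_trans _ _ (\sum_(h < k) b h *
     (\sum_(j < l) c j * Bs h `^ j%:R + (\prod_(i < l) K i.+1) * Q * Bs h `^ (r + l%:R)))).
    by apply: ler_sum => h _; rewrite ler_wpM2l ?b0 ?bound.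
  under eq_bigr do rewrite mulrDr mulr_sumr.
  rewrite big_split/= exchange_big/=; apply: lerD.
    apply: ler_sum => j _; under eq_bigr do rewrite mulrCA.
    by rewrite -mulr_sumr ler_wpM2l ?c0 ?sum_mul_powR_le.
  under eq_bigr do rewrite mulrCA.
  by rewrite -mulr_sumr ler_wpM2l ?mulr_ge0 ?PK0 ?sum_mul_powR_le ?addr_ge0.
move=> /(ler_wpM2l (K0 0%N isT)) h; apply: (le_trans h).
rewrite mulrDr mulr_sumr; apply: lerD.
  (* Term j of the shifted sum becomes term j + 1: K 0 completes the product and 1/(j + 1) turns j!
     into (j + 1)!. *)
  apply: ler_sum => j _; rewrite big_ord_recl /c -(natrD _ j 1) addn1 powR_mulrn//.
  rewrite /bump/= add1n factS natrM invfM.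
  by rewrite le_eqVlt; apply/orP; left; apply/eqP; rewrite -/(Bs k); ring.
rewrite big_ord_recl/= [in X in _ <= X]big_nat_recr//= -/Q -/(Bs k).
rewrite -natr1 addrA.
by rewrite le_eqVlt; apply/orP; left; apply/eqP; rewrite /bump/=; ring.
Qed.

End unrolling.

(** * Resampling one coordinate *)

Section product_space_maps.
Context {n : nat} {d : 'I_n -> measure_display} {T : forall i, measurableType (d i)}.
Implicit Types x y : prod_space T.

Lemma measurable_coord (i : 'I_n) :
  measurable_fun [set: prod_space T] (fun x : prod_space T => x i).
Proof.
move=> _ B mB; rewrite setTI; apply: sub_sigma_algebra.
by exists i => //; exists B => //; rewrite setTI.
Qed.

Lemma measurable_fun_prod_space dS (S : measurableType dS) (f : S -> prod_space T) :
  (forall i, measurable_fun setT (fun s => f s i)) -> measurable_fun setT f.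
Proof.
move=> mf; refine (@measurability _ _ S (prod_space T) setT f (cylinders (T:=T)) _ _) => //.
move=> _ [_ [i _ [B mB <-]] <-]; rewrite !setTI.
by have := mf i measurableT B mB; rewrite setTI.
Qed.

Lemma measurable_dfwith (i : 'I_n) :
  measurable_fun [set: prod_space T * T i]
    (fun xz => dfwith xz.1 i xz.2 : prod_space T).
Proof.
apply: measurable_fun_prod_space => j; have [ij|ij] := eqVneq i j.
  case: _ / ij; rewrite [X in measurable_fun _ X](_ : _ = snd)//.
  by apply/funext => xz; exact: dfwithin.
rewrite [X in measurable_fun _ X](_ : _ = (fun xz => xz.1 j)); last first.
  by apply/funext => xz; exact: dfwithout.
apply: (@measurableT_comp _ _ _ _ _ _ (fun x : prod_space T => x j)) => //.
exact: measurable_coord.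
Qed.

(** The past is read from x, the future from y; averaging over y then conditions on the first k
    coordinates. *)
Definition splice (k : nat) x y : prod_space T := fun i => if (i < k)%N then x i else y i.

Lemma measurable_splice k :
  measurable_fun [set: prod_space T * prod_space T] (fun xy => splice k xy.1 xy.2).
Proof.
apply: measurable_fun_prod_space => i; rewrite /splice; case: ltnP => _.
  by apply: (@measurableT_comp _ _ _ _ _ _ (fun x : prod_space T => x i)) => //;
    exact: measurable_coord.
by apply: (@measurableT_comp _ _ _ _ _ _ (fun x : prod_space T => x i)) => //;
  exact: measurable_coord.
Qed.

Lemma splice0 x y : splice 0 x y = y.
Proof. by apply/functional_extensionality_dep => i; rewrite /splice ltn0. Qed.

Lemma splice_full x y : splice n x y = x.
Proof. by apply/functional_extensionality_dep => i; rewrite /splice ltn_ord. Qed.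

Lemma spliceS (i : 'I_n) x y : splice i.+1 x y = dfwith (splice i x y) i (x i).
Proof.
apply/functional_extensionality_dep => j; case: dfwithP => [|k ik].
  by rewrite /splice ltnSn.
by rewrite /splice ltnS leq_eqVlt eq_sym (negPf (_ : (i : nat) != k)).
Qed.

(** Coordinate i comes from x in [splice i.+1] and from y in [splice i]. Replacing it there gives
    the same point as in [splice_dfwithr], which is what the martingale property rests on. *)
Lemma splice_dfwithl (i : 'I_n) x y (z : T i) :
  splice i.+1 (dfwith x i z) y = dfwith (splice i x y) i z.
Proof.
apply/functional_extensionality_dep => j; rewrite /splice; case: (dfwithP x z j) => [|k ik].
  by rewrite ltnSn dfwithin.
rewrite dfwithout//.
by rewrite ltnS leq_eqVlt eq_sym (negPf (_ : (i : nat) != k)).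
Qed.

Lemma splice_dfwithr (i : 'I_n) x y (z : T i) :
  splice i x (dfwith y i z) = dfwith (splice i x y) i z.
Proof.
apply/functional_extensionality_dep => j; rewrite /splice; case: (dfwithP y z j) => [|k ik].
  by rewrite ltnn dfwithin.
by rewrite dfwithout.
Qed.

Lemma dfwith_dfwith (i : 'I_n) x (z z' : T i) : dfwith (dfwith x i z) i z' = dfwith x i z'.
Proof.
apply/functional_extensionality_dep => j; case: (dfwithP x z' j) => [|k ik].
  by rewrite dfwithin.
by rewrite !dfwithout.
Qed.

Definition box (A : forall i, set (T i)) : set (prod_space T) :=
  [set x | forall i, A i (x i)].

Lemma measurable_box A : (forall i, measurable (A i)) -> measurable (box A).
Proof.
move=> mA.
have -> : box A =
    \bigcap_(i in [set: 'I_n]) ((fun x : prod_space T => x i) @^-1` A i).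
  by apply/seteqP; split=> [x xA i _|x xA i]; apply: xA.
apply: fin_bigcap_measurable => [|i _]; first exact: finite_finset.
by have := @measurable_coord i measurableT _ (mA i); rewrite setTI.
Qed.

(** Boxes are closed under intersection, contain the whole space and generate the product
    sigma-algebra, so finite measures agreeing on them coincide. *)
Lemma prod_space_measure_ext (R : realType) (m1 m2 : {measure set prod_space T -> \bar R}) :
  (m1 setT < +oo)%E ->
  (forall A, (forall i, measurable (A i)) -> m1 (box A) = m2 (box A)) ->
  forall B, measurable B -> m1 B = m2 B.
Proof.
move=> m1T m12 B mB.
pose G := [set box A | A in [set A : forall i, set (T i) | forall i, measurable (A i)]].
have boxT : box (fun=> setT) = setT by apply/seteqP; split.
apply: (measure_unique G (fun=> setT)) => //.
- apply/seteqP; split.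
    apply: smallest_sub; first exact: smallest_sigma_algebra.
    move=> _ [i _ [C mC <-]]; rewrite setTI; apply: sub_sigma_algebra.
    (* A cylinder is the box whose other sides are full. *)
    exists (dfwith (fun=> setT) i C) => [j|].
      by case: dfwithP.
    apply/seteqP; split=> [x /(_ i)|x Cx j]; first by rewrite dfwithin.
    by case: dfwithP.
  apply: smallest_sub; first exact: sigma_algebra_measurable.
  by move=> _ [A mA <-]; exact: measurable_box.
- move=> _ _ [A mA <-] [C mC <-]; exists (fun i => A i `&` C i).
    by move=> i; exact: measurableI.
  by apply/seteqP; split=> [x h|x [hA hC] i]; split => // i; case: (h i).
- by move=> _; exists (fun=> setT).
- by rewrite bigcup_const//; exists 0%N.
- by move=> _ [A mA <-]; exact: m12.
Qed.

End product_space_maps.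

(** * Invariance of the joint law under resampling *)

Section resampling.
Context {R : realType} {dO : measure_display} {Omega : measurableType dO}
  (P : probability Omega R) {n : nat} {d : 'I_n -> measure_display}
  {T : forall i, measurableType (d i)} (X : forall i, {RV P >-> T i}).

Definition jointly (w : Omega) : prod_space T := fun i => X i w.

Lemma measurable_jointly : measurable_fun setT jointly.
Proof. by apply: measurable_fun_prod_space => i; exact: measurable_funP. Qed.

(** The second factor of [Omega * Omega] supplies an independent copy of [X k]. *)
Definition resample (k : 'I_n) (ww : Omega * Omega) : prod_space T :=
  dfwith (jointly ww.1) k (X k ww.2).

Lemma measurable_resample k : measurable_fun setT (resample k).
Proof.
have h1 : measurable_fun setT (fun ww : Omega * Omega => jointly ww.1).
  exact: (measurableT_comp measurable_jointly measurable_fst).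
have h2 : measurable_fun setT (fun ww : Omega * Omega => X k ww.2).
  exact: (measurableT_comp (measurable_funP (X k)) measurable_snd).
exact: (measurableT_comp (@measurable_dfwith _ _ T k) (measurable_fun_pair h1 h2)).
Qed.

Hypothesis hX : mutually_independent P (fun i => X i : Omega -> T i).

Lemma jointly_box (A : forall i, set (T i)) : (forall i, measurable (A i)) ->
  (P (jointly @^-1` box A) = \prod_(i < n) P (X i @^-1` A i))%E.
Proof.
move=> mA; have := hX (J := [set: 'I_n]%SET) (fun i _ => mA i).
under eq_bigl do rewrite inE.
move=> <-; congr (P _); apply/seteqP; split=> w /= h i.
  by move=> _; exact: h.
by apply: h; rewrite /= inE.
Qed.

(** It suffices to test boxes, where independence makes both sides the same product of marginal
    probabilities. *)
Lemma resample_law k (B : set (prod_space T)) : measurable B ->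
  ((P \x P) (resample k @^-1` B) = P (jointly @^-1` B))%E.
Proof.
move=> mB.
pose m1 : {measure set prod_space T -> \bar R} := pushforward (P \x P)%E (resample k).
pose m2 : {measure set prod_space T -> \bar R} := pushforward P jointly.
have prodP (A C : set Omega) : measurable A -> measurable C ->
    (P \x P)%E (A `*` C) = (P A * P C)%E.
  by move=> mA mC; rewrite product_measure1E.
apply: (@prod_space_measure_ext _ _ _ R (m1 (measurable_resample k))
  (m2 measurable_jointly)) => //.
  rewrite /m1/= /pushforward preimage_setT -setXTT prodP//.
  by rewrite probability_setT mule1 ltry.
move=> A mA; rewrite /m1 /m2/= /pushforward jointly_box//.
(* The preimage of a box is a rectangle: the constraint on coordinate k moves to the second factor
   and becomes vacuous in the first. *)
rewrite [X in (P \x P)%E X](_ : _ =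
    (jointly @^-1` box (dfwith A k setT)) `*` (X k @^-1` A k)); last first.
  apply/seteqP; split=> [[w w'] /= h|[w w'] /= [h hk] i].
    split; last by have := h k; rewrite /resample/= dfwithin.
    move=> i; case: (dfwithP A setT i) => // j kj.
    by have := h j; rewrite /resample/= dfwithout.
  rewrite /resample/=; case: dfwithP => // j kj.
  by have := h j; rewrite dfwithout.
have mk i : measurable (dfwith A k setT i) by case: dfwithP.
rewrite prodP; last 2 first.
- by have := measurable_jointly measurableT (measurable_box mk); rewrite setTI.
- by have := measurable_funP (X k) measurableT _ (mA k); rewrite setTI.
rewrite jointly_box// (bigD1 k)//= [RHS](bigD1 k)//= dfwithin preimage_setT.
rewrite probability_setT mul1e muleC; congr (_ * _)%E.
by apply: eq_bigr => i ik; rewrite dfwithout// eq_sym.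
Qed.

Lemma integral_law_resample (k : 'I_n) (f : prod_space T -> \bar R) :
  (\int[pushforward P jointly]_x f x =
   \int[pushforward (P \x P)%E (resample k)]_x f x)%E.
Proof.
apply: eq_measure_integral; [exact: measurable_resample|exact: measurable_jointly|].
by move=> ? ? A mA _; apply/esym/resample_law.
Qed.

Lemma ge0_integral_resample (k : 'I_n) (f : prod_space T -> \bar R) :
  measurable_fun [set: prod_space T] f -> (forall x, 0 <= f x)%E ->
  (\int[P]_w f (jointly w) = \int[P]_w \int[P]_w' f (dfwith (jointly w) k (X k w')))%E.
Proof.
move=> mf f0.
have := fubini_tonelli1 (m1 := P) (m2 := P) _
  (measurableT_comp mf (measurable_resample k)) (fun ww => f0 _).
rewrite /fubini_F /= => <-.
have := ge0_integral_pushforward (measurable_resample k) (P \x P)%E measurableT mf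
  (fun x _ => f0 x).
rewrite preimage_setT => <-.
have := ge0_integral_pushforward measurable_jointly P measurableT mf (fun x _ => f0 x).
rewrite preimage_setT => <-.
exact: integral_law_resample.
Qed.

(** Integrability after resampling comes from the nonnegative case applied to |f|. The fresh
    coordinate is integrated last, so that the inner integral can be read as a conditional mean. *)
Lemma integral_resample (k : 'I_n) (f : prod_space T -> \bar R) :
  measurable_fun [set: prod_space T] f -> P.-integrable setT (f \o jointly) ->
  (\int[P]_w f (jointly w) = \int[P]_w' \int[P]_w f (dfwith (jointly w) k (X k w')))%E.
Proof.
move=> mf intf.
have mfr := measurableT_comp mf (measurable_resample k).
have intr : (P \x P)%E.-integrable setT (f \o resample k).
  apply/integrableP; split => //.
  rewrite (fubini_tonelli1 (m1 := P) (m2 := P)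
    (fun ww : Omega * Omega => `|f (resample k ww)|%E)) //; last first.
    exact: measurableT_comp.
  rewrite /fubini_F/= -(ge0_integral_resample (k : 'I_n) (f := fun x => `|f x|%E))//; last first.
    exact: measurableT_comp.
  by case/integrableP : intf.
have := integral21_prod_meas1 (m1 := P) (m2 := P) intr.
rewrite /fubini_G/= => ->.
have := integral_pushforward measurable_jointly mf (D := setT) intf measurableT.
rewrite preimage_setT => <-.
have := integral_pushforward (measurable_resample k) mf (D := setT) intr measurableT.
rewrite preimage_setT => <-.
exact: integral_law_resample.
Qed.

End resampling.

(** * The Doob martingale *)

Section integral_comparison.
Context {R : realType} {dO : measure_display} {Omega : measurableType dO}
  (P : probability Omega R).

Lemma integral_probability_cst (r : R) : (\int[P]_w r%:E = r%:E)%E.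
Proof. by rewrite integral_cst//= probability_setT mule1. Qed.

(** Stated in the extended reals, so that it applies before any moment is known to be finite. *)
Lemma ge0_integral_affine (a K q : R) (f h : Omega -> R) :
  0 <= a -> 0 <= K -> 0 <= q -> (forall w, 0 <= f w) -> (forall w, 0 <= h w) ->
  measurable_fun setT f -> measurable_fun setT h ->
  (\int[P]_w (a + K * f w + q * h w)%:E =
   a%:E + K%:E * \int[P]_w (f w)%:E + q%:E * \int[P]_w (h w)%:E)%E.
Proof.
move=> a0 K0 q0 f0 h0 mf mh.
have mKf : measurable_fun setT (fun w => K * f w) by exact: measurable_funM.
have mqh : measurable_fun setT (fun w => q * h w) by exact: measurable_funM.
under eq_integral do rewrite EFinD.
rewrite ge0_integralD//; first last.
- exact/measurable_EFinP.
- by move=> w _; rewrite lee_fin mulr_ge0.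
- exact/measurable_EFinP/measurable_funD.
- by move=> w _; rewrite lee_fin addr_ge0// mulr_ge0.
under eq_integral do rewrite EFinD.
rewrite ge0_integralD//; first last.
- exact/measurable_EFinP.
- by move=> w _; rewrite lee_fin mulr_ge0.
rewrite integral_probability_cst; congr (_ + _ + _)%E.
  under eq_integral do rewrite EFinM.
  by apply: ge0_integralZl => //; [exact/measurable_EFinP|move=> w _; rewrite lee_fin].
under eq_integral do rewrite EFinM.
by apply: ge0_integralZl => //; [exact/measurable_EFinP|move=> w _; rewrite lee_fin].
Qed.

(** The term l (Z - m) integrates to zero. Every use of the centering of an increment passes through
    this form. *)
Lemma le_integral_up_to_linear (phi psi Z : Omega -> R) (m l : R) :
  measurable_fun setT phi -> measurable_fun setT psi ->
  (forall w, 0 <= phi w) -> (forall w, 0 <= psi w) ->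
  P.-integrable setT (EFin \o Z) -> (\int[P]_w (Z w)%:E = m%:E)%E ->
  (forall w, phi w <= psi w + l * (Z w - m)) ->
  (\int[P]_w (phi w)%:E <= \int[P]_w (psi w)%:E)%E.
Proof.
move=> mphi mpsi phi0 psi0 intZ Zm le.
have [->|psifin] := eqVneq (\int[P]_w (psi w)%:E)%E +oo%E; first by rewrite leey.
have intpsi : P.-integrable setT (EFin \o psi).
  apply/integrableP; split; first exact/measurable_EFinP.
  under eq_integral => w _ do rewrite /= ger0_norm//.
  by rewrite ltey.
have intm : P.-integrable setT (EFin \o cst m) by exact: finite_measure_integrable_cst.
have intZm : P.-integrable setT (fun w => (Z w)%:E - (cst m w)%:E)%E by exact: integrableB.
have intl := integrableZl measurableT l intZm.
apply: (@le_trans _ _ (\int[P]_w ((psi w)%:E + l%:E * ((Z w)%:E - (cst m w)%:E)))%E).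
  apply: ge0_le_integral => //.
  - by move=> w _; rewrite lee_fin.
  - exact/measurable_EFinP.
  - by have /integrableP[] := integrableD measurableT intpsi intl.
  - by move=> w _; rewrite -EFinB -EFinM -EFinD lee_fin.
rewrite integralD// integralZl// integralB_EFin// Zm.
by rewrite (integral_probability_cst m) subee// mule0 adde0.
Qed.

Lemma measurable_norm_powR d' (T' : measurableType d') (f : T' -> R) (s : R) :
  measurable_fun setT f -> measurable_fun setT (fun w => `|f w| `^ s).
Proof.
move=> mf; apply: (@measurableT_comp _ _ _ _ _ _ (fun z : R => z `^ s)).
  exact: measurable_powR.
exact: measurableT_comp.
Qed.

(** Monotonicity of L^r norms up to r = 2, derived from weighted AM-GM with a free parameter M. *)
Lemma low_moment_le (f : Omega -> R) (r B : R) : measurable_fun setT f ->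
  0 <= r <= 2 -> (\int[P]_w (f w ^+ 2)%:E <= B%:E)%E ->
  (\int[P]_w (`|f w| `^ r)%:E <= (B `^ (r / 2))%:E)%E.
Proof.
move=> mf /andP[r0 r2] hB.
move: r0; rewrite le_eqVlt => /predU1P[<-|r0].
  by under eq_integral do rewrite powRr0; rewrite mul0r powRr0 integral_probability_cst.
have mf2 : measurable_fun setT (fun w => f w ^+ 2) by exact: (measurable_funX 2 mf).
have m0 : measurable_fun setT (fun _ : Omega => 0 : R) by exact: measurable_cst.
have r2' : 0 < r / 2 by rewrite divr_gt0.
have th : 0 <= r / 2 <= 1 by apply/andP; split; lra.
have young (M : R) w : 0 <= M ->
    M `^ (1 - r / 2) * `|f w| `^ r <= (1 - r / 2) * M + r / 2 * f w ^+ 2.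
  move=> M0; have := powR_weighted_mean (sqr_ge0 (f w)) M0 th.
  rewrite -real_normK ?num_real// -powR_mulrn// -powRrM.
  by rewrite (_ : 2 * (r / 2) = r); [lra|field].
have integrated (M : R) : 0 <= M ->
    ((M `^ (1 - r / 2))%:E * \int[P]_w (`|f w| `^ r)%:E <=
     ((1 - r / 2) * M + r / 2 * B)%:E)%E.
  move=> M0.
  have fr0 w : setT w -> (0 <= (`|f w| `^ r)%:E)%E by rewrite lee_fin powR_ge0.
  have mfr : measurable_fun setT (fun w => (`|f w| `^ r)%:E).
    by apply/measurable_EFinP; exact: measurable_norm_powR.
  have Mr0 : (0 <= (M `^ (1 - r / 2))%:E)%E by rewrite lee_fin powR_ge0.
  rewrite -(ge0_integralZl P measurableT mfr fr0 Mr0).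
  have c0 : 0 <= (1 - r / 2) * M by rewrite mulr_ge0//; lra.
  (* The null summand fits the three-term shape of [ge0_integral_affine]. *)
  apply: (@le_trans _ _ (\int[P]_w ((1 - r / 2) * M + r / 2 * f w ^+ 2 + 0 * 0)%:E)%E).
    apply: ge0_le_integral => //.
    - by move=> w _; rewrite -EFinM lee_fin mulr_ge0 ?powR_ge0.
    - exact: measurable_funeM.
    - apply/measurable_EFinP; apply: measurable_funD => //.
      by apply: measurable_funD => //; exact: measurable_funM.
    - by move=> w _; rewrite -EFinM lee_fin mul0r addr0 young.
  rewrite (ge0_integral_affine c0 (ltW r2') (lexx 0) (fun w => sqr_ge0 (f w))
    (fun=> lexx 0) mf2 m0) mul0e adde0 EFinD leeD2l// EFinM.
  by apply: lee_wpmul2l hB; rewrite lee_fin ltW.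
(* M = 1 already yields finiteness. *)
have fin : (\int[P]_w (`|f w| `^ r)%:E)%E \is a fin_num.
  rewrite ge0_fin_numE; last by apply: integral_ge0 => w _; rewrite lee_fin powR_ge0.
  by have := integrated 1 ler01; rewrite powR1 mul1e => /le_lt_trans; apply; rewrite ltry.
rewrite -(fineK fin); set A := fine _; rewrite lee_fin.
have A0 : 0 <= A by apply: fine_ge0; apply: integral_ge0 => w _; rewrite lee_fin powR_ge0.
move: A0; rewrite le_eqVlt => /predU1P[<-|A0]; first exact: powR_ge0.
(* For this M the bound reads M <= (1 - r/2) M + (r/2) B, that is M <= B. *)
pose M := A `^ (2 / r).
have M0 : 0 < M by exact: powR_gt0.
have AM : A = M `^ (r / 2).
  by rewrite /M -powRrM (_ : 2 / r * (r / 2) = 1) ?powRr1 ?ltW//; field; rewrite gt_eqF.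
have := integrated M (ltW M0); rewrite -(fineK fin) -/A -EFinM lee_fin {1}AM.
rewrite -powRD; last by rewrite (gt_eqF M0) implybT.
rewrite subrK powRr1 ?(ltW M0)// => h.
rewrite AM; apply: ler_wpowR2; [exact: ltW|exact: ltW|].
by rewrite -(ler_pM2l r2'); lra.
Qed.

End integral_comparison.

Lemma admissible_p_gt0 (R : realType) (p q : R -> R) (s : R) :
  admissible p q -> 2 <= s -> 0 < p s.
Proof.
move=> h; rewrite le_eqVlt => /predU1P[<-|s2]; first exact: admissible_p2 h.
exact: lt_le_trans ltr01 (admissible_p_ge1 h s2).
Qed.

Lemma admissible_q_gt0 (R : realType) (p q : R -> R) (s : R) :
  admissible p q -> 2 <= s -> 0 < q s.
Proof.
move=> h; rewrite le_eqVlt => /predU1P[<-|s2]; first exact: admissible_q2 h.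
exact: lt_le_trans ltr01 (admissible_q_ge1 h s2).
Qed.

(** * Conditional means and their increments *)

Section conditional_means.
Context {R : realType} {dO : measure_display} {Omega : measurableType dO}
  (P : probability Omega R) {n : nat} {d : 'I_n -> measure_display}
  {T : forall i, measurableType (d i)} (X : forall i, {RV P >-> T i}).
Hypothesis hX : mutually_independent P (fun i => X i : Omega -> T i).
Variable g : prod_space T -> R.
Hypothesis hg : measurable_fun [set: prod_space T] g.
Variable rho : forall i : 'I_n, T i * T i -> R.
Arguments rho : clear implicits.
Hypothesis hrho : forall i : 'I_n, measurable_fun [set: T i * T i] (rho i).
Hypothesis hLip : separately_Lipschitz g rho.
Hypothesis intY : P.-integrable setT (EFin \o (g \o jointly X)).
Variable xb : forall i, T i.
Hypothesis intrho :
  forall i, P.-integrable setT (fun w => (rho i (X i w, xb i))%:E).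
Implicit Types x y : prod_space T.

Lemma Lipschitz_dfwith (i : 'I_n) x (z z' : T i) :
  `|g (dfwith x i z) - g (dfwith x i z')| <= rho i (z, z').
Proof. by have := hLip (dfwith x i z') z; rewrite dfwith_dfwith dfwithin. Qed.

Lemma Lipschitz_ge0 (i : 'I_n) (z z' : T i) : 0 <= rho i (z, z').
Proof. exact: le_trans (normr_ge0 _) (Lipschitz_dfwith xb z z'). Qed.

(** A version of the conditional mean of Y given the first k coordinates, defined at every point x;
    [fine] is harmless for k <= n by [integrable_splice]. *)
Definition cond_mean (k : nat) x : R :=
  fine (\int[P]_w (g (splice k x (jointly X w)))%:E).

Lemma measurable_splice_jointly k x :
  measurable_fun setT (fun w => g (splice k x (jointly X w))).
Proof.
apply: (measurableT_comp hg).
apply: (measurableT_comp (measurable_splice k)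
  (measurable_fun_pair (measurable_cst x) (measurable_jointly X))).
Qed.

Lemma measurable_cond_mean k : measurable_fun [set: prod_space T] (cond_mean k).
Proof.
apply: (measurableT_comp (fine_measurable measurableT)).
pose F (xw : prod_space T * Omega) : \bar R := (g (splice k xw.1 (jointly X xw.2)))%:E.
have mF : measurable_fun setT F.
  apply/measurable_EFinP; apply: (measurableT_comp hg).
  exact: (measurableT_comp (measurable_splice k) (measurable_fun_pair measurable_fst
    (measurableT_comp (measurable_jointly X) measurable_snd))).
(* Tonelli measurability concerns nonnegative functions, so the positive and negative parts are
   treated apart. *)
rewrite [X in measurable_fun _ X](_ : _ =
    (fun x => fubini_F P F^\+ x - fubini_F P F^\- x)%E).
  by apply: emeasurable_funB; apply: measurable_fun_fubini_tonelli_F => //;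
    [exact: measurable_funepos|exact: measurable_funeneg].
apply/funext => x; rewrite integralE; congr (_ - _)%E; apply: eq_integral => w _.
  by rewrite !funeposE.
by rewrite !funenegE.
Qed.

(** Freezing coordinate k at x k, by way of xb k, changes g by at most rho(x k, xb k) + rho(X k, xb
    k), which is integrable. The conclusion holds for every x, with no exceptional null set. *)
Lemma integrable_splice k x : (k <= n)%N ->
  P.-integrable setT (fun w => (g (splice k x (jointly X w)))%:E).
Proof.
elim: k => [_|k IH kn].
  by under eq_fun do rewrite splice0.
pose i := Ordinal kn.
have intc : P.-integrable setT (EFin \o cst (rho i (x i, xb i))).
  exact: finite_measure_integrable_cst.
have int1 := integrable_norm (IH (ltnW kn)).
have int2 := integrableD measurableT (integrableD measurableT int1 (intrho i)) intc.
apply: le_integrable int2 => //.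
  exact/measurable_EFinP/measurable_splice_jointly.
move=> w _ /=; rewrite lee_fin.
set y := jointly X w; set u := splice k x y.
have -> : splice k.+1 x y = dfwith u i (x i) by exact: spliceS i x y.
(* Coordinate i of u is still the random one, which lets [X i w] be traded for [xb i]. *)
have uE : u = dfwith u i (X i w).
  apply/functional_extensionality_dep => j; case: dfwithP => //.
  by rewrite /u /splice ltnn.
have h1 := Lipschitz_dfwith u (x i) (xb i).
have h2 := Lipschitz_dfwith u (X i w) (xb i); rewrite -uE in h2.
rewrite [leRHS]ger0_norm ?addr_ge0 ?Lipschitz_ge0//.
have h3 := ler_distD (g u) (g (dfwith u i (x i))) 0.
rewrite !subr0 in h3; apply: (le_trans h3).
have h4 := ler_distD (g (dfwith u i (xb i))) (g (dfwith u i (x i))) (g u).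
rewrite (distrC (g (dfwith u i (xb i))) (g u)) in h4.
lra.
Qed.

Lemma cond_meanE k x : (k <= n)%N ->
  (cond_mean k x)%:E = (\int[P]_w (g (splice k x (jointly X w)))%:E)%E.
Proof. by move=> kn; rewrite fineK// integrable_fin_num//; exact: integrable_splice. Qed.

Lemma cond_mean0 x : cond_mean 0 x = fine (\int[P]_w (g (jointly X w))%:E).
Proof. by rewrite /cond_mean; congr fine; apply: eq_integral => w _; rewrite splice0. Qed.

Lemma cond_mean_full x : cond_mean n x = g x.
Proof.
rewrite /cond_mean; under eq_integral do rewrite splice_full.
by rewrite integral_probability_cst.
Qed.

(** The martingale property: resample coordinate i inside the average defining [cond_mean i x], then
    read the inner integral as [cond_mean i.+1]. *)
Lemma cond_mean_step (i : 'I_n) x :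
  (\int[P]_w (cond_mean i.+1 (dfwith x i (X i w)))%:E = (cond_mean i x)%:E)%E.
Proof.
rewrite cond_meanE; last exact: ltnW.
have mf : measurable_fun setT (fun y : prod_space T => (g (splice i x y))%:E).
  apply/measurable_EFinP; apply: (measurableT_comp hg).
  exact: (measurableT_comp (measurable_splice i)
    (measurable_fun_pair (measurable_cst x) (@measurable_id _ _ setT))).
rewrite (integral_resample hX i mf); last first.
  by apply: integrable_splice; exact: ltnW.
apply: eq_integral => w _; rewrite cond_meanE//; apply: eq_integral => w' _.
by rewrite splice_dfwithr splice_dfwithl.
Qed.

Lemma cond_mean_Lipschitz (i : 'I_n) x (z z' : T i) :
  `|cond_mean i.+1 (dfwith x i z) - cond_mean i.+1 (dfwith x i z')| <= rho i (z, z').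
Proof.
have int u := integrable_splice (dfwith x i u) (ltn_ord i).
have intB : P.-integrable setT
    (EFin \o (fun w => g (splice i.+1 (dfwith x i z) (jointly X w))
    - g (splice i.+1 (dfwith x i z') (jointly X w)))).
  exact: (integrableB measurableT (int z) (int z')).
rewrite /cond_mean -[fine _]/(Rintegral P setT _) -[X in _ - X]/(Rintegral P setT _).
rewrite -(RintegralB measurableT (int z) (int z')).
apply: le_trans (le_normr_Rintegral measurableT intB) _.
rewrite -[leRHS]mulr1 -[X in _ * X]/(fine 1%:E) -(probability_setT P).
rewrite -(Rintegral_cst P measurableT).
apply: le_Rintegral => //.
- exact: integrable_norm.
- exact: finite_measure_integrable_cst.
- by move=> w _; rewrite !splice_dfwithl Lipschitz_dfwith.
Qed.

Lemma measurable_rho_coord (i : 'I_n) (z : T i) :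
  measurable_fun setT (fun w => rho i (X i w, z)).
Proof.
have h : measurable_fun setT (fun w => (X i w, z)).
  by apply: measurable_fun_pair; [exact: measurable_funP|exact: measurable_cst].
exact: (measurableT_comp (@hrho i) h).
Qed.

(** The martingale difference with the past frozen at x; only the new coordinate depends on w. *)
Definition increment (i : 'I_n) x (w : Omega) : R :=
  cond_mean i.+1 (dfwith x i (X i w)) - cond_mean i x.

Lemma measurable_cond_mean_dfwith (i : 'I_n) x :
  measurable_fun setT (fun w => cond_mean i.+1 (dfwith x i (X i w))).
Proof.
apply: (measurableT_comp (measurable_cond_mean i.+1)).
exact: (measurableT_comp (@measurable_dfwith _ _ T i)
  (measurable_fun_pair (measurable_cst (x : prod_space T)) (measurable_funP (X i)))).
Qed.

Lemma measurable_increment2 (i : 'I_n) :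
  measurable_fun setT (fun ww : Omega * Omega => increment i (jointly X ww.1) ww.2).
Proof.
apply: measurable_funB.
  exact: (measurableT_comp (measurable_cond_mean i.+1) (measurable_resample X i)).
exact: (measurableT_comp (measurable_cond_mean i)
  (measurableT_comp (measurable_jointly X) measurable_fst)).
Qed.

Lemma measurable_increment (i : 'I_n) x : measurable_fun setT (increment i x).
Proof. exact: measurable_funB (measurable_cond_mean_dfwith i x) (measurable_cst _). Qed.

Lemma integrable_cond_mean_dfwith (i : 'I_n) x :
  P.-integrable setT (fun w => (cond_mean i.+1 (dfwith x i (X i w)))%:E).
Proof.
have intc : P.-integrable setT (EFin \o cst (`|cond_mean i.+1 (dfwith x i (xb i))|)).
  exact: finite_measure_integrable_cst.
apply: le_integrable (integrableD measurableT (intrho i) intc) => //.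
  exact/measurable_EFinP/measurable_cond_mean_dfwith.
move=> w _ /=; rewrite lee_fin [leRHS]ger0_norm ?addr_ge0 ?Lipschitz_ge0//.
rewrite -lerBlDr (le_trans (lerB_dist _ _))//.
exact: cond_mean_Lipschitz.
Qed.

(** The increment is centered and lies within rho of a function recentered at the value for [xb i];
    [recentering] pays the factor [Ct t]. *)
Lemma increment_powR_le (i : 'I_n) x (t : R) : 2 < t ->
  (\int[P]_w (`|increment i x w| `^ t)%:E <=
   (Ct t)%:E * \int[P]_w (rho i (X i w, xb i) `^ t)%:E)%E.
Proof.
move=> t2; have C0 : 0 <= Ct t by rewrite (le_trans ler01)// Ct_ge1.
have mr : measurable_fun setT (fun w => rho i (X i w, xb i) `^ t).
  exact: (measurableT_comp (measurable_powR t) (measurable_rho_coord (xb i))).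
have [l hl] := recentering (cond_mean i.+1 (dfwith x i (xb i))) (cond_mean i x) t2.
rewrite -ge0_integralZl//; [|exact/measurable_EFinP|by move=> w _; rewrite lee_fin powR_ge0].
apply: (le_integral_up_to_linear _ _ _ _ (integrable_cond_mean_dfwith i x)
  (cond_mean_step i x) (l := l)).
- exact/measurable_norm_powR/measurable_increment.
- exact: measurable_funM.
- by move=> w; exact: powR_ge0.
- by move=> w; rewrite mulr_ge0// powR_ge0.
move=> w; apply: (le_trans (hl _)); rewrite lerD2r ler_wpM2l//.
by apply: ler_wpowR2 => //; [lra|exact: cond_mean_Lipschitz].
Qed.

(** The variance is the least second moment about a constant: (Z - m)^2 = (Z - c)^2 + 2(c - m)(Z -
    m) - (c - m)^2. *)
Lemma increment_sqr_le (i : 'I_n) x (z : T i) :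
  (\int[P]_w (increment i x w ^+ 2)%:E <= \int[P]_w (rho i (X i w, z) ^+ 2)%:E)%E.
Proof.
pose c := cond_mean i.+1 (dfwith x i z).
apply: (le_integral_up_to_linear _ _ _ _ (integrable_cond_mean_dfwith i x)
  (cond_mean_step i x) (l := 2 * (c - cond_mean i x))).
- exact: (measurable_funX 2 (measurable_increment i x)).
- exact: (measurable_funX 2 (measurable_rho_coord z)).
- by move=> w; exact: sqr_ge0.
- by move=> w; exact: sqr_ge0.
move=> w; rewrite /increment.
have := cond_mean_Lipschitz x (X i w) z; rewrite -/c.
set Z := cond_mean i.+1 _; set m := cond_mean i x => h.
apply: (@le_trans _ _ ((Z - c) ^+ 2 + 2 * (c - m) * (Z - m))).
  have : 0 <= (c - m) ^+ 2 by exact: sqr_ge0.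
  rewrite !expr2; lra.
rewrite lerD2r -real_normK ?num_real// lerXn2r ?nnegrE//.
exact: le_trans h.
Qed.

(** With the past frozen, the Taylor bound is integrated over the new coordinate: its linear term
    vanishes and its quadratic term is controlled by b. *)
Lemma moment_step (i : 'I_n) (z : T i) (b s p q c : R) : 2 <= s -> 0 <= p -> 0 <= q ->
  (forall u v : R, `|u + v| `^ (s - 2) <= p * `|u| `^ (s - 2) + q * `|v| `^ (s - 2)) ->
  (\int[P]_w (rho i (X i w, z) ^+ 2)%:E <= b%:E)%E ->
  (\int[P]_w (`|cond_mean i.+1 (jointly X w) - c| `^ s)%:E <=
   \int[P]_w (`|cond_mean i (jointly X w) - c| `^ s)%:E +
   (s * (s - 1) * p / 2 * b)%:E * \int[P]_w (`|cond_mean i (jointly X w) - c| `^ (s - 2))%:E +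
   q%:E * \int[P]_w \int[P]_w' (`|increment i (jointly X w) w'| `^ s)%:E)%E.
Proof.
move=> s2 p0 q0 hpq hb.
have K0 : 0 <= s * (s - 1) * p / 2 by rewrite divr_ge0// mulr_ge0// mulr_ge0//; lra.
have b0 : 0 <= b.
  rewrite -lee_fin; apply: le_trans hb; apply: integral_ge0 => w _.
  by rewrite lee_fin sqr_ge0.
have mS k r : measurable_fun setT (fun w => `|cond_mean k (jointly X w) - c| `^ r).
  apply: measurable_norm_powR; apply: measurable_funB => //.
  exact: measurableT_comp (measurable_cond_mean k) (measurable_jointly X).
have mII : measurable_fun setT
    (fun w => \int[P]_w' (`|increment i (jointly X w) w'| `^ s)%:E)%E.
  have mI : measurable_fun setT (fun ww : Omega * Omega =>
      (`|increment i (jointly X ww.1) ww.2| `^ s)%:E).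
    by apply/measurable_EFinP/measurable_norm_powR; exact: measurable_increment2.
  apply: (@measurable_fun_fubini_tonelli_F _ _ _ _ _ P _ mI) => ww.
  by rewrite lee_fin powR_ge0.
have mcond k : measurable_fun setT (fun y : prod_space T => (`|cond_mean k y - c| `^ s)%:E).
  by apply/measurable_EFinP/measurable_norm_powR/measurable_funB => //;
    exact: measurable_cond_mean.
have cond0 k (y : prod_space T) : (0 <= (`|cond_mean k y - c| `^ s)%:E)%E.
  by rewrite lee_fin powR_ge0.
(* Resampling coordinate i separates the new value from the past. *)
rewrite [leLHS](ge0_integral_resample hX i (mcond i.+1) (cond0 i.+1)).
pose S0 w := cond_mean i (jointly X w) - c.
pose E1 w := (`|S0 w| `^ s)%:E; pose E2 w := (`|S0 w| `^ (s - 2))%:E.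
pose E3 w := (\int[P]_w' (`|increment i (jointly X w) w'| `^ s)%:E)%E.
have E10 w : setT w -> (0 <= E1 w)%E by rewrite lee_fin powR_ge0.
have E20 w : setT w -> (0 <= E2 w)%E by rewrite lee_fin powR_ge0.
have E30 w : setT w -> (0 <= E3 w)%E.
  by move=> _; apply: integral_ge0 => w' _; rewrite lee_fin powR_ge0.
have mE1 : measurable_fun setT E1 by exact/measurable_EFinP/mS.
have mE2 : measurable_fun setT E2 by exact/measurable_EFinP/mS.
have Kb0 : (0 <= (s * (s - 1) * p / 2 * b)%:E)%E by rewrite lee_fin mulr_ge0.
have q0' : (0 <= q%:E)%E by rewrite lee_fin.
rewrite -(ge0_integralZl P measurableT mE2 E20 Kb0).
rewrite -(ge0_integralZl P measurableT mII E30 q0').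
have mE2' : measurable_fun setT (fun w => (s * (s - 1) * p / 2 * b)%:E * E2 w)%E.
  exact: measurable_funeM.
have mE3' : measurable_fun setT (fun w => q%:E * E3 w)%E by exact: measurable_funeM.
have E20' w : setT w -> (0 <= (s * (s - 1) * p / 2 * b)%:E * E2 w)%E.
  by move=> _; rewrite mule_ge0// E20.
have E30' w : setT w -> (0 <= q%:E * E3 w)%E by move=> _; rewrite mule_ge0// E30.
rewrite -(ge0_integralD P measurableT E10 mE1 E20' mE2').
rewrite -(ge0_integralD P measurableT _ _ E30' mE3'); last 2 first.
- by move=> w _; rewrite adde_ge0 ?E10 ?E20'.
- exact: emeasurable_funD.
refine (ge0_le_integral P measurableT _ _ _ _).
- by move=> w _; apply: integral_ge0 => w' _; exact: cond0.
- have mr := measurableT_comp (mcond i.+1) (measurable_resample X i).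
  by apply: (@measurable_fun_fubini_tonelli_F _ _ _ _ _ P _ mr) => ww; exact: cond0.
- by apply: emeasurable_funD => //; exact: emeasurable_funD.
move=> w _; set x := jointly X w.
have mi : measurable_fun setT (fun w' => (`|increment i x w'| `^ s)).
  exact/measurable_norm_powR/measurable_increment.
have mi2 : measurable_fun setT (fun w' => (increment i x w' ^+ 2)).
  exact: (measurable_funX 2 (measurable_increment i x)).
pose K' := s * (s - 1) * p / 2 * `|S0 w| `^ (s - 2).
have K'0 : 0 <= K' by rewrite mulr_ge0 ?powR_ge0.
apply: (@le_trans _ _ (\int[P]_w' (`|S0 w| `^ s + K' * increment i x w' ^+ 2 +
   q * `|increment i x w'| `^ s)%:E)%E).
  apply: (le_integral_up_to_linear _ _ _ _ (integrable_cond_mean_dfwith i x)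
    (cond_mean_step i x) (l := s * (S0 w * `|S0 w| `^ (s - 2)))).
  - by apply/measurable_norm_powR/measurable_funB; first exact: measurable_cond_mean_dfwith.
  - apply: measurable_funD; last exact: measurable_funM.
    by apply: measurable_funD => //; exact: measurable_funM.
  - by move=> w'; rewrite powR_ge0.
  - move=> w'; apply: addr_ge0; last exact: mulr_ge0 q0 (powR_ge0 _ _).
    exact: addr_ge0 (powR_ge0 _ _) (mulr_ge0 K'0 (sqr_ge0 _)).
  move=> w'; have := norm_powR_taylor (S0 w) (increment i x w') s2 hpq.
  have -> : S0 w + increment i x w' = cond_mean i.+1 (dfwith x i (X i w')) - c.
    by rewrite /S0 /increment -/x; ring.
  by rewrite /K' /increment; apply.
rewrite (ge0_integral_affine P (powR_ge0 _ _) K'0 q0 (fun w' => sqr_ge0 _)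
  (fun w' => powR_ge0 _ _) mi2 mi).
rewrite leeD2r// leeD2l// /K'; set k := s * (s - 1) * p / 2 in K0 *.
rewrite (EFinM k) (EFinM k b) -!muleA [X in (_ <= _ * X)%E]muleC.
apply: lee_wpmul2l; first by rewrite lee_fin.
apply: lee_wpmul2l; first by rewrite lee_fin powR_ge0.
exact: le_trans (increment_sqr_le x z) hb.
Qed.

(** * Moments along the martingale *)

Variable yb : forall i, T i.
Variable b : 'I_n -> R.
Hypothesis rho2_le : forall i, (\int[P]_w (rho i (X i w, yb i) ^+ 2)%:E <= (b i)%:E)%E.

(** Extension by zero to all natural indices, as partial sums over time require. *)
Definition extend0 (f : 'I_n -> R) (k : nat) : R := oapp f 0 (insub k).

Lemma extend0E (f : 'I_n -> R) (i : 'I_n) : extend0 f i = f i.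
Proof. by rewrite /extend0 valK. Qed.

Lemma extend0_ge0 (f : 'I_n -> R) : (forall i, 0 <= f i) -> forall k, 0 <= extend0 f k.
Proof. by move=> f0 k; rewrite /extend0; case: insub => //=. Qed.

Definition central_moment (c s : R) (k : nat) : \bar R :=
  (\int[P]_w (`|cond_mean k (jointly X w) - c| `^ s)%:E)%E.

Definition increment_moment (s : R) (i : 'I_n) : \bar R :=
  (\int[P]_w \int[P]_w' (`|increment i (jointly X w) w'| `^ s)%:E)%E.

Lemma b_ge0 i : 0 <= b i.
Proof.
rewrite -lee_fin; apply: le_trans (rho2_le i); apply: integral_ge0 => w _.
by rewrite lee_fin sqr_ge0.
Qed.

Lemma central_moment_ge0 c s k : (0 <= central_moment c s k)%E.
Proof. by apply: integral_ge0 => w _; rewrite lee_fin powR_ge0. Qed.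

Lemma increment_moment_ge0 s i : (0 <= increment_moment s i)%E.
Proof.
by apply: integral_ge0 => w _; apply: integral_ge0 => w' _; rewrite lee_fin powR_ge0.
Qed.

Let EY := fine (\int[P]_w (g (jointly X w))%:E).

(** The martingale starts at the constant [EY]; order 0 is excluded because 0^0 = 1. *)
Lemma central_moment_start s : s != 0 -> central_moment EY s 0 = 0%E.
Proof.
move=> s0; rewrite /central_moment; under eq_integral.
  by move=> w _; rewrite cond_mean0 subrr normr0 powR0//; over.
by rewrite integral_cst//= mul0e.
Qed.

(** [moment_step] at s = 2 with p = 1 and q = 0: the moment of order 0 is 1 and the coefficient of b
    is 1. *)
Lemma second_moment_le k : (k <= n)%N ->
  (central_moment EY 2 k <= (\sum_(i < k) extend0 b i)%:E)%E.
Proof.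
elim: k => [_|k IH kn]; first by rewrite central_moment_start// big_ord0.
pose i := Ordinal kn.
have h : forall u v : R, `|u + v| `^ (2 - 2) <= 1 * `|u| `^ (2 - 2) + 0 * `|v| `^ (2 - 2).
  by move=> u v; rewrite subrr !powRr0; lra.
apply: (le_trans (moment_step EY (lexx 2) ler01 (lexx 0) h (rho2_le i))).
rewrite mul0e adde0 subrr; under [X in (_ + _ * X)%E]eq_integral do rewrite powRr0.
rewrite integral_probability_cst mule1 big_ord_recr/= EFinD leeD ?IH ?(ltnW kn)//.
by rewrite lee_fin -[k]/(nat_of_ord i) extend0E; lra.
Qed.

Lemma central_moment_low_le r k : 0 <= r <= 2 -> (k <= n)%N ->
  (central_moment EY r k <= ((\sum_(i < k) extend0 b i) `^ (r / 2))%:E)%E.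
Proof.
move=> r02 kn; apply: low_moment_le => //.
  apply: measurable_funB => //.
  exact: measurableT_comp (measurable_cond_mean k) (measurable_jointly X).
apply: le_trans (second_moment_le kn); rewrite /central_moment.
by under [leRHS]eq_integral do rewrite powR_mulrn// real_normK ?num_real//.
Qed.

Variables (t : R) (tau : 'I_n -> R).
Hypothesis t2 : 2 < t.
Hypothesis rhot_le : forall i, (\int[P]_w (rho i (X i w, xb i) `^ t)%:E <= (tau i)%:E)%E.

(** Transfers a pointwise inequality between powers to the increments, uniformly in the past. It
    serves both finiteness and the interpolation. *)
Lemma increment_moment_le (s D E1 E2 : R) i : 0 <= D -> 0 <= E1 -> 0 <= E2 ->
  (forall y : R, 0 <= y -> D * y `^ s <= E1 * y `^ t + E2 * y ^+ 2) ->
  (D%:E * increment_moment s i <= (E1 * (Ct t * tau i) + E2 * b i)%:E)%E.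
Proof.
move=> D0 E10 E20 hy.
have mi x r : measurable_fun setT (fun w' => `|increment i x w'| `^ r).
  exact/measurable_norm_powR/measurable_increment.
have inner w : (D%:E * \int[P]_w' (`|increment i (jointly X w) w'| `^ s)%:E <=
    (E1 * (Ct t * tau i) + E2 * b i)%:E)%E.
  set x := jointly X w.
  have mi2 : measurable_fun setT (fun w' => increment i x w' ^+ 2).
    exact: (measurable_funX 2 (measurable_increment i x)).
  have is0 w' : setT w' -> (0 <= (`|increment i x w'| `^ s)%:E)%E by rewrite lee_fin powR_ge0.
  have mis : measurable_fun setT (fun w' => (`|increment i x w'| `^ s)%:E).
    by apply/measurable_EFinP; exact: mi.
  have D0' : (0 <= D%:E)%E by rewrite lee_fin.
  rewrite -(ge0_integralZl P measurableT mis is0 D0').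
  apply: (@le_trans _ _ (\int[P]_w' (0 + E1 * (`|increment i x w'| `^ t) +
      E2 * increment i x w' ^+ 2)%:E)%E).
    apply: ge0_le_integral => //.
    - by move=> w' _; rewrite -EFinM lee_fin mulr_ge0 ?powR_ge0.
    - exact: measurable_funeM.
    - apply/measurable_EFinP; apply: measurable_funD; last exact: measurable_funM.
      by apply: measurable_funD => //; exact: measurable_funM.
    - move=> w' _; rewrite -EFinM lee_fin add0r.
      by have := hy _ (normr_ge0 (increment i x w')); rewrite real_normK ?num_real.
  rewrite (ge0_integral_affine P (lexx 0) E10 E20 (fun w' => powR_ge0 _ _)
    (fun w' => sqr_ge0 _) (mi x t) mi2) add0e EFinD !EFinM; apply: leeD.
    apply: lee_wpmul2l; first by rewrite lee_fin.
    apply: le_trans (increment_powR_le i x t2) _.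
    apply: lee_wpmul2l (rhot_le i); rewrite lee_fin (le_trans ler01)// Ct_ge1//.
  apply: lee_wpmul2l; first by rewrite lee_fin.
  exact: le_trans (increment_sqr_le x (yb i)) (rho2_le i).
have mII : measurable_fun setT
    (fun w => \int[P]_w' (`|increment i (jointly X w) w'| `^ s)%:E)%E.
  have mI : measurable_fun setT (fun ww : Omega * Omega =>
      (`|increment i (jointly X ww.1) ww.2| `^ s)%:E).
    by apply/measurable_EFinP/measurable_norm_powR; exact: measurable_increment2.
  apply: (@measurable_fun_fubini_tonelli_F _ _ _ _ _ P _ mI) => ww.
  by rewrite lee_fin powR_ge0.
have I0 w : (0 <= \int[P]_w' (`|increment i (jointly X w) w'| `^ s)%:E)%E.
  by apply: integral_ge0 => w' _; rewrite lee_fin powR_ge0.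
rewrite /increment_moment -ge0_integralZl//.
rewrite -[leRHS](integral_probability_cst P).
apply: ge0_le_integral => //.
- by move=> w _; rewrite mule_ge0.
- exact: measurable_funeM.
Qed.

Variables (p q : R -> R) (lambda : nat -> R).
Hypothesis hpq : admissible p q.
Hypothesis hlambda : forall j, (j < half_floor t)%N -> 0 < lambda j.

Lemma moment_bound :
  (central_moment EY t n <= (Ct t * CA p q lambda t * \sum_i tau i +
     CB p q lambda t * (\sum_i b i) `^ (t / 2))%:E)%E.
Proof.
(* [lra] does not see section hypotheses. *)
have t2' := t2.
pose m := half_floor t.
have t0 : 0 < t by exact: lt_trans t2.
have mt : m%:R <= t / 2 < m.+1%:R by apply: truncn_itv; rewrite divr_ge0// ltW.
(* The orders of the successive levels: at least 2 before level m, and between 0 and 2 at level m,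
   where the second moment takes over. *)
pose s j : R := t - 2 * j%:R.
have s_ge2 j : (j < m)%N -> 2 <= s j.
  move=> jm; have : j.+1%:R <= m%:R :> R by rewrite ler_nat.
  by rewrite -(natr1 j) /s; case/andP: mt; lra.
have sS j : s j - 2 = s j.+1 by rewrite /s -(natr1 j); ring.
have sm : 0 <= s m <= 2.
  by move: mt; rewrite -(natr1 m) /s => /andP[? ?]; apply/andP; split; lra.
have p_ge0 j : (j < m)%N -> 0 <= p (s j).
  move=> /s_ge2 sj; exact: ltW (admissible_p_gt0 hpq sj).
have q_ge0 j : (j < m)%N -> 0 <= q (s j).
  move=> /s_ge2 sj; exact: ltW (admissible_q_gt0 hpq sj).
pose B k := \sum_(i < k) extend0 b i.
have BE : B n = \sum_i b i by apply: eq_bigr => i _; rewrite extend0E.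
have B0 : 0 <= B n by rewrite BE sumr_ge0// => i _; exact: b_ge0.
have interp j (la y : R) : (j < m)%N -> 0 < la -> 0 <= y ->
    B n ^+ j * y `^ s j <=
    (s j - 2) / (t - 2) * (la ^+ (2 * j))^-1 * y `^ t +
    2 * j%:R / (t - 2) * la `^ (s j - 2) * B n `^ (t / 2 - 1) * y ^+ 2.
  move=> jm la0 y0; rewrite -(mulrA _ (B n `^ _)).
  by apply: powR_interpolation => //; have := s_ge2 _ jm; rewrite /s; lra.
(* Since 2 <= s j <= t, y^(s j) <= y^t + y^2. *)
have imfin j i : (j < m)%N -> increment_moment (s j) i \is a fin_num.
  move=> jm; rewrite ge0_fin_numE ?increment_moment_ge0//.
  have := @increment_moment_le (s j) 1 1 1 i ler01 ler01 ler01.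
  rewrite mul1e => /(_ _)/le_lt_trans; apply; last exact: ltry.
  move=> y y0; rewrite !mul1r.
  have sj := s_ge2 _ jm; have st : s j <= t by rewrite /s lerBlDr lerDl.
  have [y1|/ltW y1] := leP y 1.
    have [->|yn0] := eqVneq y 0; first by rewrite !powR0 ?gt_eqF ?addr_ge0//; lra.
    apply: (@le_trans _ _ (y ^+ 2)); last by rewrite lerDr powR_ge0.
    by rewrite -powR_mulrn//; apply: ger_powR => //; rewrite y1 lt_neqAle eq_sym yn0 y0.
  apply: (@le_trans _ _ (y `^ t)); last by rewrite lerDl sqr_ge0.
  exact: ler_powR.
have step j (i : 'I_n) : (j < m)%N -> (central_moment EY (s j) i.+1 <=
    central_moment EY (s j) i +
    (s j * (s j - 1) * p (s j) / 2 * b i)%:E * central_moment EY (s j.+1) i +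
    (q (s j))%:E * increment_moment (s j) i)%E.
  move=> jm; rewrite -sS.
  exact: (moment_step EY (s_ge2 _ jm) (p_ge0 _ jm) (q_ge0 _ jm)
    (fun u v : R => norm_powR_quasi_triangle u v hpq (s_ge2 _ jm)) (rho2_le i)).
have lowfin k : (k <= n)%N -> central_moment EY (s m) k \is a fin_num.
  move=> kn; rewrite ge0_fin_numE ?central_moment_ge0//.
  by rewrite (le_lt_trans (central_moment_low_le sm kn))// ltry.
(* Induction on time for all levels at once, as the step at level j also calls on level j + 1. *)
have cmfin k j : (k <= n)%N -> (j <= m)%N -> central_moment EY (s j) k \is a fin_num.
  elim: k j => [|k IH] j kn; rewrite leq_eqVlt => /predU1P[->|jm].
  - exact: lowfin.
  - by rewrite central_moment_start// gt_eqF// (lt_le_trans _ (s_ge2 _ jm)).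
  - exact: lowfin.
  rewrite ge0_fin_numE ?central_moment_ge0//.
  have h := step j (Ordinal kn) jm; apply: (le_lt_trans h) => /=.
  rewrite -(fineK (IH j (ltnW kn) (ltnW jm))) -(fineK (IH j.+1 (ltnW kn) jm)).
  by rewrite -(fineK (imfin j (Ordinal kn) jm)) -!EFinM -!EFinD ltry.
pose al j k := fine (central_moment EY (s j) k).
pose a j k := extend0 (fun i => fine (increment_moment (s j) i)) k.
have a0 j i : 0 <= a j i.
  by apply: extend0_ge0 => k; apply: fine_ge0; exact: increment_moment_ge0.
pose K j := s j * (s j - 1) * p (s j) / 2.
have K0 j : (j < m)%N -> 0 <= K j.
  move=> jm; have := s_ge2 _ jm; have := p_ge0 _ jm => p0 s2.
  by rewrite divr_ge0// mulr_ge0// mulr_ge0//; lra.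
have r0 : 0 <= t / 2 - m%:R by rewrite subr_ge0; case/andP: mt.
have := @unroll_recursion R m n K (q \o s) (extend0 b) a al (t / 2 - m%:R) r0 K0 q_ge0
  (extend0_ge0 b_ge0) (fun j i _ => a0 j i).
have al0 j : (j < m)%N -> al j 0%N = 0.
  by move=> jm; rewrite /al central_moment_start// gt_eqF// (lt_le_trans _ (s_ge2 _ jm)).
have alS j k : (j < m)%N -> (k < n)%N ->
    al j k.+1 <= al j k + K j * extend0 b k * al j.+1 k + (q \o s) j * a j k.
  move=> jm kn; have := step j (Ordinal kn) jm => /=.
  rewrite -(fineK (cmfin k.+1 j kn (ltnW jm))) -(fineK (cmfin k j (ltnW kn) (ltnW jm))).
  rewrite -(fineK (cmfin k j.+1 (ltnW kn) jm)) -(fineK (imfin j (Ordinal kn) jm)).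
  rewrite -!EFinM -!EFinD lee_fin.
  have -> : b (Ordinal kn) = extend0 b k := esym (extend0E b (Ordinal kn)).
  have -> : fine (increment_moment (s j) (Ordinal kn)) = a j k :=
    esym (extend0E (fun i => fine (increment_moment (s j) i)) (Ordinal kn)).
  by [].
have allast k : (k <= n)%N -> al m k <= (\sum_(i < k) extend0 b i) `^ (t / 2 - m%:R).
  move=> kn; rewrite /al -lee_fin fineK ?cmfin//.
  have -> : t / 2 - m%:R = s m / 2 by rewrite /s; field.
  exact: central_moment_low_le.
move=> /(_ al0 alS allast n (leqnn n)).
have s0 : s 0%N = t by rewrite /s mulr0 subr0.
rewrite -lee_fin {1}/al fineK ?cmfin// s0 => h; apply: (le_trans h); rewrite lee_fin.
rewrite subrK -!/(B n) {h}.
pose Ts := \sum_i tau i.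
have pp j : \prod_(i < j) K i = pprod p t j by [].
pose E1 j := (s j - 2) / (t - 2) * (lambda j ^+ (2 * j))^-1.
pose E2 j := 2 * j%:R / (t - 2) * lambda j `^ (s j - 2).
have main j : (j < m)%N -> B n ^+ j * \sum_(i < n) a j i <=
    E1 j * (Ct t * Ts) + E2 j * B n `^ (t / 2).
  move=> jm; have la0 := hlambda jm; have s2 := s_ge2 _ jm.
  have E10 : 0 <= E1 j.
    by rewrite mulr_ge0 ?invr_ge0 ?exprn_ge0 ?divr_ge0 ?(ltW la0)//; lra.
  have E20 : 0 <= E2 j.
    by rewrite mulr_ge0 ?powR_ge0// divr_ge0 ?mulr_ge0//; lra.
  (* Splitting off one factor B distributes B^(t/2) over the increments, matching the b i from the
     second-moment bound. *)
  have -> : B n `^ (t / 2) = \sum_i b i * B n `^ (t / 2 - 1).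
    by rewrite -mulr_suml -BE mulr_powRB1//; lra.
  rewrite /Ts !mulr_sumr -big_split/=; apply: ler_sum => i _.
  rewrite /a extend0E -lee_fin EFinM fineK ?imfin//.
  have := @increment_moment_le (s j) (B n ^+ j) (E1 j) (E2 j * B n `^ (t / 2 - 1)) i
    (exprn_ge0 _ B0) E10 (mulr_ge0 E20 (powR_ge0 _ _))
    (fun z z0 => interp j (lambda j) z jm la0 z0).
  by rewrite -(mulrA (E2 j) _ (b i)) (mulrC _ (b i)).
(* The constants are regrouped level by level, to be compared term by term with the unrolled
   recursion. *)
have -> : Ct t * CA p q lambda t * Ts + CB p q lambda t * (\sum_i b i) `^ (t / 2) =
    \sum_(j < m) (pprod p t j * q (s j) / j`!%:R) *
      (E1 j * (Ct t * Ts) + E2 j * B n `^ (t / 2)) +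
    pprod p t m * (B n `^ (t / 2) * \prod_(1 <= j < m.+1) (t / 2 - m%:R + j%:R)^-1).
  have eA : Ct t * CA p q lambda t * Ts = \sum_(j < m)
      cj p q t j * ((t - 2 * j%:R - 2) / (t - 2)) *
      (lambda j ^+ (2 * j) * j`!%:R)^-1 * (Ct t * Ts).
    by rewrite /CA -/m -mulr_suml; ring.
  have eB : CB p q lambda t * B n `^ (t / 2) =
      pprod p t m * \prod_(1 <= j < m.+1) (t / 2 - m%:R + j%:R)^-1 * B n `^ (t / 2) +
      \sum_(j < m) cj p q t j * (2 * j%:R / (t - 2)) *
        (lambda j `^ (t - 2 * j%:R - 2) / j`!%:R) * B n `^ (t / 2).
    by rewrite /CB -/m mulrDl mulr_suml.
  rewrite -BE eA eB addrCA -big_split/= addrC; congr (_ + _); last by ring.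
  apply: eq_bigr => j _; rewrite /cj /E1 /E2 /s invfM; ring.
rewrite lerD2r; apply: ler_sum => j _; rewrite pp.
have -> : pprod p t j * (q \o s) j * (B n ^+ j / j`!%:R) * \sum_(i < n) a j i =
   pprod p t j * q (s j) / j`!%:R * (B n ^+ j * \sum_(i < n) a j i) by rewrite /=; ring.
apply: ler_wpM2l (main j (ltn_ord j)).
rewrite divr_ge0// mulr_ge0 ?q_ge0// -pp; apply: prodr_ge0 => i _.
by apply: K0; exact: ltn_trans (ltn_ord i) (ltn_ord j).
Qed.
End conditional_means.

(** * The theorem *)

Section constants_positivity.
Context {R : realType} (p q : R -> R) (lambda : nat -> R) (t : R).
Hypotheses (t2 : 2 < t) (hpq : admissible p q).
Hypothesis hlambda : forall j, (j < half_floor t)%N -> 0 < lambda j.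

Let half_floor_le : (half_floor t)%:R <= t / 2.
Proof. by rewrite truncn_le divr_ge0// ltW// (lt_trans _ t2). Qed.

Let half_floor_gt0 : (0 < half_floor t)%N.
Proof. by rewrite truncn_gt_nat ler_pdivlMr// mul1r ltW. Qed.

Let arg_ge2 j : (j < half_floor t)%N -> 2 <= t - 2 * j%:R.
Proof.
move=> jm; have : j.+1%:R <= (half_floor t)%:R :> R by rewrite ler_nat.
by rewrite -(natr1 j); move: half_floor_le; lra.
Qed.

Lemma pprod_gt0 j : (j <= half_floor t)%N -> 0 < pprod p t j.
Proof.
move=> jm; apply: prodr_gt0 => k _.
have s2 := arg_ge2 (leq_trans (ltn_ord k) jm).
rewrite divr_gt0// mulr_gt0 ?(admissible_p_gt0 hpq s2)// mulr_gt0//; lra.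
Qed.

Let cj_gt0 j : (j < half_floor t)%N -> 0 < cj p q t j.
Proof.
by move=> jm; rewrite mulr_gt0 ?(admissible_q_gt0 hpq (arg_ge2 jm)) ?pprod_gt0// ltnW.
Qed.

(** Strict positivity makes the right side of the theorem infinite when a t-th moment of some rho is
    infinite. *)
Lemma CA_gt0 : 0 < CA p q lambda t.
Proof.
have term j : (j < half_floor t)%N -> 0 <= (t - 2 * j%:R - 2) / (t - 2).
  by move=> jm; rewrite divr_ge0//; have := arg_ge2 jm; move: t2; lra.
have fact_gt0R j : 0 < j`!%:R :> R by rewrite ltr0n fact_gt0.
(* The term j = 0 equals q(t) > 0; the others are nonnegative. *)
rewrite /CA (bigD1 (Ordinal half_floor_gt0))//= ltr_wpDr//.
  apply: sumr_ge0 => j _; rewrite mulr_ge0//.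
    by rewrite mulr_ge0 ?term// ltW// cj_gt0.
  by rewrite invr_ge0 mulr_ge0 ?exprn_ge0 ?(ltW (fact_gt0R _))// ltW// hlambda.
rewrite mulr0 subr0 divff; last by rewrite subr_eq0 gt_eqF.
by rewrite muln0 expr0 fact0 !mulr1 invr1 mulr1 cj_gt0.
Qed.

Lemma CB_gt0 : 0 < CB p q lambda t.
Proof.
rewrite /CB ltr_wpDr//.
  apply: sumr_ge0 => j _; apply: mulr_ge0; last by rewrite divr_ge0 ?powR_ge0.
  apply: mulr_ge0; first by rewrite ltW// cj_gt0.
  by rewrite divr_ge0 ?mulr_ge0 ?subr_ge0// ltW.
rewrite mulr_gt0 ?pprod_gt0//; rewrite big_nat_cond; apply: prodr_gt0 => j.
rewrite andbT => /andP[j0 _]; rewrite invr_gt0 ltr_wpDl// ?subr_ge0// ltr0n.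
exact: j0.
Qed.

End constants_positivity.

Theorem corollary3 (R : realType)
    (dO : measure_display) (Omega : measurableType dO) (P : probability Omega R)
    (n : nat) (d : 'I_n -> measure_display)
    (T : forall i : 'I_n, measurableType (d i))
    (X : forall i : 'I_n, {RV P >-> T i})
    (hX : mutually_independent P (fun i => X i : Omega -> T i))
    (g : prod_space T -> R) (hg : measurable_fun [set: prod_space T] g)
    (rho : forall i : 'I_n, T i * T i -> R)
    (hrho : forall i : 'I_n, measurable_fun [set: T i * T i] (rho i))
    (hLip : separately_Lipschitz g rho) :
  let Y := fun w : Omega => g (fun i => X i w) in
  P.-integrable [set: Omega] (EFin \o Y) ->
  forall (t : R), 2 < t ->
  forall (p q : R -> R), admissible p q ->
  forall (lambda : nat -> R),
    (forall j : nat, (j < half_floor t)%N -> 0 < lambda j) ->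
  forall x y : (forall i : 'I_n, T i),
  ('E_P[fun w => (`|Y w - fine 'E_P[Y]| `^ t)%R] <=
   (Ct t * CA p q lambda t)%:E *
     (\sum_(i < n) 'E_P[fun w => (rho i (X i w, x i) `^ t)%R]) +
   (CB p q lambda t)%:E *
     (\sum_(i < n) 'E_P[fun w => (rho i (X i w, y i) ^+ 2)%R]) `^ (t / 2))%E.
Proof.
move=> Y intY t t2 p q hpq lambda hlambda x y.
rewrite !expectation.unlock.
pose Et i := (\int[P]_w (rho i (X i w, x i) `^ t)%:E)%E.
pose E2 i := (\int[P]_w (rho i (X i w, y i) ^+ 2)%:E)%E.
rewrite -[X in (_ <= _ * X + _)%E]/(\sum_i Et i)%E.
rewrite -[X in (_ <= _ + _ * X `^ _)%E]/(\sum_i E2 i)%E.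
have Et0 i : (0 <= Et i)%E by apply: integral_ge0 => w _; rewrite lee_fin powR_ge0.
have E20 i : (0 <= E2 i)%E by apply: integral_ge0 => w _; rewrite lee_fin sqr_ge0.
have ac : 0 < Ct t * CA p q lambda t.
  by rewrite mulr_gt0 ?CA_gt0// (lt_le_trans ltr01)// Ct_ge1.
have bc : 0 < CB p q lambda t by exact: CB_gt0.
have t20 : 0 < t / 2 by rewrite divr_gt0// (lt_trans _ t2).
have a0 : (0 <= (Ct t * CA p q lambda t)%:E * \sum_i Et i)%E.
  by rewrite mule_ge0 ?sume_ge0// lee_fin ltW.
have b0 : (0 <= (CB p q lambda t)%:E * (\sum_i E2 i) `^ (t / 2))%E.
  by rewrite mule_ge0 ?poweR_ge0// lee_fin ltW.
(* An infinite moment makes the bound trivial; otherwise all of them become real numbers. *)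
have [Etfin|/existsNP[i /negP Eti]] := pselect (forall i, Et i \is a fin_num); last first.
  have -> : (\sum_i Et i = +oo)%E.
    apply/eqP; rewrite esum_eqy; last by move=> j _; rewrite -ltNye (lt_le_trans _ (Et0 j)).
    by apply/existsP; exists i; move: Eti; rewrite ge0_fin_numE// -leNgt leye_eq => ->.
  by rewrite gt0_muley ?lte_fin// addye ?leey// -ltNye (lt_le_trans _ b0).
have [E2fin|/existsNP[i /negP E2i]] := pselect (forall i, E2 i \is a fin_num); last first.
  have -> : (\sum_i E2 i = +oo)%E.
    apply/eqP; rewrite esum_eqy; last by move=> j _; rewrite -ltNye (lt_le_trans _ (E20 j)).
    by apply/existsP; exists i; move: E2i; rewrite ge0_fin_numE// -leNgt leye_eq => ->.
  by rewrite poweRyr ?gt_eqF// gt0_muley ?lte_fin// addey ?leey// -ltNye (lt_le_trans _ a0).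
have rho0 i (z z' : T i) : 0 <= rho i (z, z') by exact: (Lipschitz_ge0 hLip x).
(* Integrability follows from r <= 1 + r^t for r >= 0. *)
have intrho i : P.-integrable setT (fun w => (rho i (X i w, x i))%:E).
  have mr := measurable_rho_coord X hrho (x i).
  have mrt : measurable_fun setT (fun w => rho i (X i w, x i) `^ t).
    exact: (measurableT_comp (measurable_powR t) mr).
  have int1 : P.-integrable setT (EFin \o cst 1) by exact: finite_measure_integrable_cst.
  have intt : P.-integrable setT (fun w => (rho i (X i w, x i) `^ t)%:E).
    apply/integrableP; split; first exact/measurable_EFinP.
    under eq_integral do rewrite gee0_abs ?lee_fin ?powR_ge0//.
    by rewrite -ge0_fin_numE ?Etfin ?Et0.
  apply: le_integrable (integrableD measurableT int1 intt) => //.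
    exact/measurable_EFinP.
  move=> w _ /=; rewrite lee_fin !ger0_norm ?addr_ge0 ?powR_ge0//.
  have [r1|/ltW r1] := leP (rho i (X i w, x i)) 1.
    by apply: (le_trans r1); rewrite lerDl powR_ge0.
  have t1 : 1 <= t by move: t2; lra.
  by apply: (le_trans (le1r_powR r1 t1)); rewrite lerDr.
have tauE i : (Et i <= (fine (Et i))%:E)%E by rewrite fineK.
have bE i : (E2 i <= (fine (E2 i))%:E)%E by rewrite fineK.
have := moment_bound hX hg hrho hLip intY intrho bE t2 tauE hpq hlambda.
rewrite EFinD (EFinM (Ct t * _) (\sum_i _)) (EFinM (CB p q lambda t)).
rewrite -poweR_EFin -!sumEFin.
have sumK (F : 'I_n -> \bar R) : (forall i, F i \is a fin_num) ->
    (\sum_i (fine (F i))%:E = \sum_i F i)%E.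
  by move=> Ffin; apply: eq_bigr => i _; rewrite fineK.
rewrite (sumK Et Etfin) (sumK E2 E2fin).
(* At time n the conditional mean is g itself. *)
apply: le_trans; rewrite /central_moment le_eqVlt; apply/orP; left; apply/eqP.
by apply: eq_integral => w _; rewrite cond_mean_full.
Qed.
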